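(* Let $L\ge1$ and let $K$ be an index set. For each $N\in\mathbb N$ let $\mathbf A_{N,1}=(A_{N,1}^{(k)})_{k\in K},\ldots,\mathbf A_{N,L}=(A_{N,L}^{(k)})_{k\in K}$ be independent families of $N\times N$ random matrices that are uniformly bounded in operator norm. Assume moreover that each family, except possibly one, is permutation invariant. Write $\mathbf A_N=\mathbf A_{N,1}\cup\cdots\cup\mathbf A_{N,L}$. Then $\mathbf A_{N,1},\ldots,\mathbf A_{N,L}$ are asymptotically free with amalgamation in the operator-valued probability space $(\mathcal A_N,\mathcal B_N,\Delta)$ in the following sense. Let $n\ge2$, let $\ell_1,\ldots,\ell_n\in\{1,\ldots,L\}$ with $\ell_1\ne\ell_2\ne\cdots\ne\ell_n$ (consecutive indices distinct), and let $P_{N,1},\ldots,P_{N,n}\in\mathcal B_N\langle X_k:k\in K\rangle$ be explicitly given by $$P_{N,i}=g_{0,i}(\mathbf A_N)X_{k_i(1)}g_{1,i}(\mathbf A_N)\cdots X_{k_i(d_i)}g_{d_i,i}(\mathbf A_N),$$ where each $g_{j,i}$ is a cactus-type monomial, and the $d_i$, $k_i(\cdot)\in K$ and $g_{j,i}$ do not depend on $N$. Then the matrix $$\varepsilon_N:=\Delta\Big[\big(P_{N,1}(\mathbf A_{N,\ell_1})-\Delta P_{N,1}(\mathbf A_{N,\ell_1})\big)\cdots\big(P_{N,n}(\mathbf A_{N,\ell_n})-\Delta P_{N,n}(\mathbf A_{N,\ell_n})\big)\Big]$$ satisfies, for every $p\ge1$, $$\mathbb E\Big[\tfrac1N\mathrm{Tr}\big[(\varepsilon_N\varepsilon_N^*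 )^p\big]\Big]\underset{N\to\infty}{\longrightarrow}0.$$
   Context: $\Delta$ is the diagonal map $\Delta A=(\delta_{i,j}A(i,j))_{i,j=1}^N$ on $N\times N$ matrices. $\mathcal M_N(L^\infty)$ is the algebra of $N\times N$ matrices of bounded complex random variables. $\mathcal A_N$ is the smallest unital subalgebra of $\mathcal M_N(L^\infty)$ containing the matrices of $\mathbf A_N$ and closed under $\Delta$, and $\mathcal B_N=\Delta(\mathcal A_N)$. $\mathcal B_N\langle X_k:k\in K\rangle$ is the algebra generated by freely noncommuting indeterminates $(X_k)_{k\in K}$ and $\mathcal B_N$; $P(\mathbf A_{N,\ell})$ denotes substitution of $X_k=A_{N,\ell}^{(k)}$. A graph monomial $g$ is a finite connected directed graph $G=(V,E,v_{in},v_{out})$ (multiple edges and loops allowed) with two roots $v_{in},v_{out}\in V$ (input and output, possibly equal), and edge labels $\ell:E\to\{1,\ldots,L\}$, $k:E\to K$. Its evaluation is the $N\times N$ matrix $$g(\mathbf A_N)(i,j)=\sum_{\substack{\phi:V\to[N]\\ \phi(v_{in})=j,\ \phi(v_{out})=i}}\ \prod_{e=(v,w)\in E}A_{N,\ell(e)}^{(k(e))}(\phi(w),\phi(v)),\qquad [N]=\{1,\ldots,N\}.$$ A connected graph is a cactus if every edge belongs to exactly one simple cycle (a loop is a simple cycle; a single vertex without edges is a cactus); an oriented cactus is a cactus each of whose simple cycles is directed. A cactus-type monomial is a graph monomial whose graph is an oriented cactus and whose input and output are equal. (The matrices $g(\mathbf A_N)$, $g$ cactus-type, lie in $\mathcal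 B_N$.) Independence: for each $N$, the $L$ families are independent. Uniformly bounded in operator norm: there is a constant $C$ such that almost surely $\|A_{N,\ell}^{(k)}\|\le C$ for all $N,\ell,k$. $K$ does not depend on $N$. A family $(A_N^{(k)})_{k\in K}$ is permutation invariant if for every permutation matrix $S$ of size $N$, $(A_N^{(k)})_{k\in K}$ and $(SA_N^{(k)}S^{-1})_{k\in K}$ have the same joint distribution. *)

(* Defs.v *)
From HB Require Import structures.
From mathcomp Require Import all_boot all_order all_algebra.
From mathcomp Require Export complex.
From mathcomp Require Export all_classical all_reals all_analysis.

Set Implicit Arguments.
Unset Strict Implicit.
Unset Printing Implicit Defensive.

Import Order.TTheory GRing.Theory Num.Theory.
Import numFieldNormedType.Exports.

Local Open Scope classical_set_scope.
Local Open Scope ring_scope.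

Definition diag_part (C : pzRingType) (n : nat) (A : 'M[C]_n) : 'M[C]_n :=
  \matrix_(i, j) (A i j *+ (i == j)).

Definition adjoint (R : realType) (m n : nat) (A : 'M[R[i]]_(m, n)) :
  'M[R[i]]_(n, m) := (map_mx Num.conj A)^T.

Definition l2norm (R : realType) (n : nat) (v : 'cV[R[i]]_n) : R :=
  Num.sqrt (\sum_i (complex.Re (v i 0) ^+ 2 + complex.Im (v i 0) ^+ 2)).

Definition opnorm (R : realType) (n : nat) (A : 'M[R[i]]_n) : R :=
  sup [set l2norm (A *m v) | v in [set v : 'cV[R[i]]_n | l2norm v <= 1]].

(* Graph monomials and cacti *)

(* [gm_src e] and [gm_tgt e] are the v and the w of the edge e = (v, w). The
   graph is connected in the undirected sense. *)
Record graph_monomial (L : nat) (K : Type) := GraphMonomial {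
  gm_vertex : finType;
  gm_edge : finType;
  gm_src : gm_edge -> gm_vertex;
  gm_tgt : gm_edge -> gm_vertex;
  gm_in : gm_vertex;
  gm_out : gm_vertex;
  gm_family : gm_edge -> 'I_L;
  gm_index : gm_edge -> K;
  gm_connected : forall u v : gm_vertex,
    connect (fun x y => [exists e,
      ((gm_src e, gm_tgt e) == (x, y)) || ((gm_src e, gm_tgt e) == (y, x))])
    u v
}.

Definition gm_eval (C : comNzRingType) (L : nat) (K : Type) (N : nat)
    (A : 'I_L -> K -> 'M[C]_N) (g : graph_monomial L K) : 'M[C]_N :=
  \matrix_(i, j)
    \sum_(phi : {ffun gm_vertex g -> 'I_N}
          | (phi (gm_in g) == j) && (phi (gm_out g) == i))
      \prod_(e : gm_edge g)
        A (gm_family e) (gm_index e) (phi (gm_tgt e)) (phi (gm_src e)).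

(* The edge set of a closed walk v_1 -e_1- v_2 -e_2- ... v_m -e_m- v_1 with
   m >= 1, distinct vertices and distinct edges, where [joins e v w] says that
   e may be traversed from v to w. The walk is stored as the sequence of the
   pairs (v_i, e_i). A loop is the case m = 1, and two parallel edges give the
   case m = 2. *)
Definition closed_walk_edges (V E : finType) (joins : E -> rel V)
    (Z : {set E}) : Prop :=
  exists p : seq (V * E),
    [/\ p != [::], path.cycle (fun a b => joins a.2 a.1 b.1) p,
        uniq (unzip1 p), uniq (unzip2 p) & Z = [set:: unzip2 p]].

(* A simple cycle, as a subgraph, is determined by its edge set. *)
Definition simple_cycle (L : nat) (K : Type) (g : graph_monomial L K) :
    {set gm_edge g} -> Prop :=
  closed_walk_edges (fun e v w =>
    ((gm_src e, gm_tgt e) == (v, w)) || ((gm_src e, gm_tgt e) == (w, v))).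

Definition directed_cycle (L : nat) (K : Type) (g : graph_monomial L K) :
    {set gm_edge g} -> Prop :=
  closed_walk_edges (fun e v w => (gm_src e, gm_tgt e) == (v, w)).

Definition cactus (L : nat) (K : Type) (g : graph_monomial L K) : Prop :=
  forall e : gm_edge g, exists! Z : {set gm_edge g}, simple_cycle Z /\ e \in Z.

Definition oriented_cactus (L : nat) (K : Type) (g : graph_monomial L K) :
    Prop :=
  cactus g /\ forall Z : {set gm_edge g}, simple_cycle Z -> directed_cycle Z.

Definition cactus_type (L : nat) (K : Type) (g : graph_monomial L K) : Prop :=
  oriented_cactus g /\ gm_in g = gm_out g.

(* Monomials b_0 X_{k(1)} b_1 ... X_{k(d)} b_d with coefficients b_j in B *)

Record bmonomial (B K : Type) := BMonomial {
  bm_degree : nat;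
  bm_var : 'I_bm_degree -> K;
  bm_coef : 'I_bm_degree.+1 -> B
}.

Arguments bm_var {B K} b.
Arguments bm_coef {B K} b.

Definition bm_map (B B' K : Type) (f : B -> B') (Q : bmonomial B K) :
    bmonomial B' K :=
  BMonomial (bm_var Q) (fun j => f (bm_coef Q j)).

Definition bm_subst (B : pzRingType) (K : Type) (x : K -> B)
    (Q : bmonomial B K) : B :=
  bm_coef Q ord0 *
  \prod_(j < bm_degree Q) (x (bm_var Q j) * bm_coef Q (lift ord0 j)).

(* Random families of matrices *)

(* The product sigma-algebra on K-indexed families of complex matrices, that
   is, the one generated by the real and imaginary parts of the entries. *)
Definition family_measurable (R : realType) (K : Type) (n : nat) :
    set (set (K -> 'M[R[i]]_n)) :=
  <<s [set B : set (K -> 'M[R[i]]_n) |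
        exists (k : K) (i j : 'I_n) (U : set R), measurable U /\
          (B = [set a : K -> 'M[R[i]]_n | U (complex.Re (a k i j))] \/
           B = [set a : K -> 'M[R[i]]_n | U (complex.Im (a k i j))])] >>.

Definition random_matrix (R : realType) d (T : measurableType d) (n : nat)
    (X : T -> 'M[R[i]]_n) : Prop :=
  forall i j : 'I_n,
    measurable_fun setT (fun w => complex.Re (X w i j)) /\
    measurable_fun setT (fun w => complex.Im (X w i j)).

Definition same_law (R : realType) d (T : measurableType d)
    (P : probability T R) (K : Type) (n : nat)
    (X Y : K -> T -> 'M[R[i]]_n) : Prop :=
  forall B, @family_measurable R K n B ->
    P [set w | B (X ^~ w)] = P [set w | B (Y ^~ w)].

Definition permutation_invariant (R : realType) d (T : measurableType d)
    (P : probability T R) (K : Type) (n : nat)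
    (X : K -> T -> 'M[R[i]]_n) : Prop :=
  forall S : 'M[R[i]]_n, is_perm_mx S ->
    same_law P X (fun k w => S *m X k w *m invmx S).

Definition independent_families (R : realType) d (T : measurableType d)
    (P : probability T R) (L : nat) (K : Type) (n : nat)
    (X : 'I_L -> K -> T -> 'M[R[i]]_n) : Prop :=
  forall (J : {set 'I_L}) (B : 'I_L -> set (K -> 'M[R[i]]_n)),
    (forall l, l \in J -> family_measurable (B l)) ->
    P [set w | forall l, l \in J -> B l (X l ^~ w)] =
    (\prod_(l in J) P [set w | B l (X l ^~ w)])%E.

(* P_{N,i}: the coefficients g_{j,i} are replaced by the matrices g_{j,i}(A),
   where A consists of the matrices of all the families. *)
Definition diag_monomial (R : realType) (L : nat) (K : Type) (N : nat)
    (A : 'I_L -> K -> 'M[R[i]]_N) (Q : bmonomial (graph_monomial L K) K) :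
    bmonomial 'M[R[i]]_N K :=
  bm_map (gm_eval A) Q.

Definition centered (C : pzRingType) (n : nat) (A : 'M[C]_n) : 'M[C]_n :=
  A - diag_part A.

Definition epsilon (R : realType) (L : nat) (K : Type) (N : nat)
    (A : 'I_L -> K -> 'M[R[i]]_N) (n : nat) (ell : 'I_n -> 'I_L)
    (Q : 'I_n -> bmonomial (graph_monomial L K) K) : 'M[R[i]]_N :=
  diag_part
    (\prod_(i < n) centered (bm_subst (A (ell i)) (diag_monomial A (Q i)))).

(* Main.v *)
From HB Require Import structures.
Require Import Defs.
From mathcomp Require Import all_boot all_order all_algebra.
From mathcomp Require Import perm measurable_realfun.

Set Implicit Arguments.
Unset Strict Implicit.
Unset Printing Implicit Defensive.

(** Expanding all products, the trace of the p-th power of eps eps^* is a sum,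
    over the maps phi from the vertices of a fixed graph to [N], of products of
    matrix entries, one for each edge; the centerings require phi(u) <> phi(v)
    for the two ends of each factor. Such graphs are called nets below, and
    [net_moment] is the net of the theorem. It is connected, and in each of its
    quotients all degrees are even, because cacti and closed walks decompose
    into cycles.

    By independence and permutation invariance, the families may be conjugated
    by independent uniform permutations sigma_l without changing the expectation
    of the trace; the exceptional family is no obstacle, since conjugating all
    families by a common permutation does not change the trace at all. It is
    therefore enough to show that, for deterministic matrices of norm at most c,
    the average of the trace over the permutations sigma_l is bounded
    independently of N ([norm_average_trace]): the factor 1/N of the normalized
    trace does the rest.

    Sort the maps phi by their kernels. In the quotient graph of a kernel that
    respects the constraints, the main walk changes colour after each factor and
    never stays at the same vertex, so that its first return closes a cycle that
    passes through two colours at some vertex x0. Hence, for some colour l, the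
    quotient graph remains connected when x0 is split into a half that carries
    the edges of colour l and a half that carries the others
    ([main_walk_splittable]). On the other hand sigma_l may be composed with the
    transposition of phi(x0) and any y outside the range of phi, which moves the
    edges of colour l at phi(x0) to y. Averaging over y, the contribution of the
    kernel becomes 1/(N - k) times a sum over the injective placements of the
    split graph ([norm_kernel_sum]), and it remains to bound the latter by a
    multiple of N ([norm_split_sum]).

    The split graph is connected, and its degrees are even except perhaps at the
    two halves of x0, so that it has an Euler trail ([euler_trail]). Along the
    trail, the sum runs over walks psi subject to equalities and distinctness
    between positions. Without constraints it is the sum of the entries of a
    product of m matrices, at most N c^m. The indicator of psi_a = psi_b is the
    expectation of u(psi_a) u(psi_b) for independent uniform signs u, which only
    inserts diagonal matrices of norm 1 in the product, and distinctness is 1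
    minus equality: the constraints cost a constant factor
    ([norm_constrained_walk_sum]). *)

(** * Connectivity and Euler trails *)
Section Connectivity.
Variables (Y E : Type) (s t : E -> Y).

(** The equivalence generated by the edges, in its impredicative form: it is
    reflexive, symmetric and transitive by computation, and an invariant of the
    edges is all that is needed to use it. *)
Definition linked (a b : Y) : Prop :=
  forall U : Y -> bool, (forall e, U (s e) = U (t e)) -> U a = U b.

Lemma linked_sym a b : linked a b -> linked b a.
Proof. by move=> ab U Ue; rewrite (ab U Ue). Qed.

Lemma linked_trans b a c : linked a b -> linked b c -> linked a c.
Proof. by move=> ab bc U Ue; rewrite (ab U Ue) (bc U Ue). Qed.

Lemma linked_edge e : linked (s e) (t e).
Proof. by move=> U; apply. Qed.

End Connectivity.

Section EulerTrails.
Variables (Y E : finType) (s t : E -> Y).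

(** A dart is an edge with a direction of traversal, [true] meaning backwards:
    an operator and its transpose have the same norm, so trails may run against
    the direction of the edges. *)
Definition dart_src (d : E * bool) : Y := if d.2 then t d.1 else s d.1.
Definition dart_tgt (d : E * bool) : Y := if d.2 then s d.1 else t d.1.

Fixpoint walk (a : Y) (p : seq (E * bool)) (b : Y) : bool :=
  if p is d :: p' then (dart_src d == a) && walk (dart_tgt d) p' b else a == b.

(** A loop counts twice, as it should for the degree. *)
Definition incidence (y : Y) (e : E) : nat := (s e == y) + (t e == y).

Definition degree (F : {set E}) (y : Y) : nat := \sum_(e in F) incidence y e.

Definition walk_vertices a (p : seq (E * bool)) : seq Y := a :: map dart_tgt p.

Lemma walk_cat a p q b c : walk a p b -> walk b q c -> walk a (p ++ q) c.
Proof.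
elim: p a => [|d p IH] a /=; first by move/eqP->.
by case/andP=> -> wp wq; rewrite (IH _ wp wq).
Qed.

Lemma walk_split a p b c : walk a p b -> c \in walk_vertices a p ->
  exists p1 p2, [/\ p = p1 ++ p2, walk a p1 c & walk c p2 b].
Proof.
elim: p a => [|d p IH] a /=.
  by move=> /eqP -> ; rewrite inE => /eqP ->; exists [::], [::]; rewrite /= eqxx.
case/andP=> da wp; rewrite inE => /orP[/eqP ->|cp].
  by exists [::], (d :: p); rewrite /= eqxx da.
have [p1 [p2 [-> w1 w2]]] := IH _ wp cp.
by exists (d :: p1), p2; rewrite /= da.
Qed.

Lemma degreeD1 (F : {set E}) e y : e \in F ->
  degree F y = incidence y e + degree (F :\ e) y.
Proof. by move=> eF; rewrite /degree (big_setD1 e). Qed.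

Lemma odd_incidence_dart d y :
  odd (incidence y d.1) = (dart_src d == y) (+) (dart_tgt d == y).
Proof.
rewrite /incidence /dart_src /dart_tgt oddD !oddb.
by case: d.2 => //; rewrite addbC.
Qed.

Lemma walk_odd_sum a p b y : walk a p b ->
  odd (\sum_(d <- p) incidence y d.1) = (a == y) (+) (b == y).
Proof.
elim: p a => [|d p IH] a /=; first by move/eqP->; rewrite big_nil addbb.
case/andP=> /eqP <- wp; rewrite big_cons oddD (IH _ wp) odd_incidence_dart.
by rewrite addbA addbK.
Qed.

(** From [a], walk along unused edges for as long as possible: by parity the
    only vertex where such a walk can get stuck is [b]. The last clause makes
    the trail nonempty when it has somewhere to go, also in the closed case a =
    b. *)
Lemma maximal_trail (F : {set E}) a b :
  (forall y, odd (degree F y) = (a == y) (+) (b == y)) ->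
  exists p, [/\ walk a p b, uniq (unzip1 p), {subset unzip1 p <= F} &
    forall e, e \in F -> 0 < incidence a e -> p != [::]].
Proof.
have [n] := ubnP #|F|; elim: n F a => // n IH F a Fn par.
case: (pickP (fun e => (e \in F) && (0 < incidence a e))) => [e /andP[eF ae]|noe].
  have [d0 d0a] : exists d0, dart_src (e, d0) = a.
    move: ae; rewrite /incidence /dart_src addn_gt0 !lt0b => /orP[]/eqP <-.
      by exists false.
    by exists true.
  pose d := (e, d0).
  have [||p [wp up sp _]] := IH (F :\ e) (dart_tgt d).
  - by rewrite (cardsD1 e F) eF in Fn.
  - move=> y; have := par y; rewrite (degreeD1 y eF) oddD (odd_incidence_dart d) d0a.
    by case: (a == y) (dart_tgt d == y) (b == y) (odd _) => [] [] [] [].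
  exists (d :: p); split=> //=.
  - by rewrite d0a eqxx.
  - by rewrite up andbT; apply/negP => /sp; rewrite !inE eqxx.
  - by move=> f; rewrite inE => /orP[/eqP ->//|/sp]; rewrite inE => /andP[].
have dF0 : degree F a = 0.
  apply: big1 => e eF; have := noe e; rewrite eF /= => /negbT.
  by rewrite -eqn0Ngt => /eqP.
have ab : a == b.
  by have := par a; rewrite dF0 eqxx /= eq_sym; case: (a == b).
exists [::]; split=> // e eF ae.
by have := noe e; rewrite eF ae.
Qed.

Lemma mem_walk_vertices_dart a p b d : walk a p b -> d \in p ->
  (dart_src d \in walk_vertices a p) && (dart_tgt d \in walk_vertices a p).
Proof.
elim: p a => [|d' p IH] a //= /andP[/eqP da wp]; rewrite inE => /orP[/eqP ->|dp].
  by rewrite da !inE !eqxx orbT.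
have /andP[h1 h2] := IH _ wp dp.
by rewrite inE h1 orbT inE h2 orbT.
Qed.

Lemma mem_walk_vertices_edge a p b e : walk a p b -> e \in unzip1 p ->
  (s e \in walk_vertices a p) && (t e \in walk_vertices a p).
Proof.
move=> wp /mapP[[e' d] dp /= ->].
have := mem_walk_vertices_dart wp dp; rewrite /dart_src /dart_tgt /=.
by case: d {dp} => // /andP[-> ->].
Qed.

(** Euler's theorem. If a trail from [a] to [b] misses an edge, connectivity
    provides a missed edge at one of its vertices; the missed edges have even
    degree everywhere, hence contain a closed trail through that vertex, which
    can be spliced in. *)
Theorem euler_trail a b :
  (forall y, odd (degree setT y) = (a == y) (+) (b == y)) ->
  (forall e, linked s t a (s e)) ->
  exists p, [/\ walk a p b, uniq (unzip1 p) & forall e, e \in unzip1 p].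
Proof.
move=> par con.
have sizeE (p : seq (E * bool)) : uniq (unzip1 p) -> size p <= #|E|.
  by move=> up; rewrite -(size_map fst p) -(card_uniqP up) max_card.
suff grow p e0 : walk a p b -> uniq (unzip1 p) -> e0 \notin unzip1 p ->
    exists p', [/\ walk a p' b, uniq (unzip1 p') & size p < size p'].
  have [p0 [wp0 up0 _ _]] := maximal_trail par.
  have [k] := ubnP (#|E| - size p0); elim: k p0 wp0 up0 => // k IH p wp up pk.
  have [/forallP all_p|] := boolP [forall e, e \in unzip1 p]; first by exists p.
  rewrite negb_forall => /existsP[e0 /(grow _ _ wp up)[p' [wp' up' pp']]].
  apply: (IH p' wp' up'); apply: (@leq_trans (#|E| - size p)) => //.
  by rewrite ltn_sub2l // (leq_trans pp') ?sizeE.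
move=> wp up e0p.
(* By connectivity some unused edge touches the trail. *)
have [e [w [ep wV we]]] : exists e w, [/\ e \notin unzip1 p,
    w \in walk_vertices a p & 0 < incidence w e].
  case: (pickP (fun e => (e \notin unzip1 p) &&
      ((s e \in walk_vertices a p) || (t e \in walk_vertices a p)))).
    move=> e /andP[ep /orP[h|h]]; exists e.
      by exists (s e); split=> //; rewrite /incidence eqxx.
    by exists (t e); split=> //; rewrite /incidence eqxx addn1.
  move=> none; exfalso.
  have inv e : (s e \in walk_vertices a p) = (t e \in walk_vertices a p).
    have [/(mem_walk_vertices_edge wp)/andP[-> ->] //|ep] := boolP (e \in unzip1 p).
    by have := none e; rewrite ep /=; case: (s e \in _); case: (t e \in _).
  have h : (a \in walk_vertices a p) = (s e0 \in walk_vertices a p).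
    exact: (con e0 (fun y => y \in walk_vertices a p) inv).
  by have := none e0; rewrite e0p -h mem_head.
pose F : {set E} := [set e | e \notin unzip1 p].
have parF y : odd (degree F y) = (w == y) (+) (w == y).
  rewrite addbb; have := par y; rewrite -(walk_odd_sum y wp).
  rewrite /degree (bigID (mem F)) /= oddD.
  rewrite (eq_bigl (mem F)) => [|e']; last by rewrite !inE.
  rewrite [X in _ (+) odd X = _](_ : _ = \sum_(d <- p) incidence y d.1).
    by case: (odd (\sum_(d <- p) _)); case: (odd _).
  rewrite -(big_map fst predT (incidence y)) big_uniq //=.
  by apply: eq_bigl => e'; rewrite !inE negbK.
have [q [wq uq sq q0]] := maximal_trail parF.
have [p1 [p2 [pE w1 w2]]] := walk_split wp wV.
exists (p1 ++ q ++ p2); split.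
- exact: walk_cat w1 (walk_cat wq w2).
- have : perm_eq (unzip1 (p1 ++ q ++ p2)) (unzip1 q ++ unzip1 p).
    by rewrite pE /unzip1 !map_cat perm_catCA.
  move/perm_uniq ->; rewrite cat_uniq uq up andbT /=.
  by apply/hasPn => f fp; apply/negP => /sq; rewrite inE fp.
have : 0 < size q by rewrite lt0n size_eq0 (q0 e) // inE.
by rewrite pE !size_cat addnCA -{1}[size p1 + _]add0n ltn_add2r.
Qed.

End EulerTrails.

Import Order.TTheory GRing.Theory Num.Theory.
Local Open Scope ring_scope.

(** * Operator bounds *)
Section OperatorBound.
Variable C : numClosedFieldType.

Definition sqnorm n (v : 'cV[C]_n) : C := \sum_i `|v i 0| ^+ 2.

(** The squared form of the inequality on the operator norm makes sense in every
    field with a norm, without square roots and without a supremum. *)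
Definition op_bounded n (A : 'M[C]_n) (c : C) : Prop :=
  forall v : 'cV[C]_n, sqnorm (A *m v) <= c ^+ 2 * sqnorm v.

Lemma sqnorm_ge0 n (v : 'cV[C]_n) : 0 <= sqnorm v.
Proof. by apply: sumr_ge0 => i _; rewrite exprn_ge0. Qed.

Lemma sqnorm_map_conj n (v : 'cV[C]_n) : sqnorm (map_mx Num.conj v) = sqnorm v.
Proof. by apply: eq_bigr => i _; rewrite mxE norm_conjC. Qed.

Lemma cauchy_schwarz (I : finType) (a b : I -> C) :
  `|\sum_i a i * b i| ^+ 2 <= (\sum_i `|a i| ^+ 2) * (\sum_i `|b i| ^+ 2).
Proof.
pose x i := `|a i|; pose y i := `|b i|.
have xr i : x i \is Num.real by exact: normr_real.
have yr i : y i \is Num.real by exact: normr_real.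
apply: (@le_trans _ _ ((\sum_i x i * y i) ^+ 2)).
  rewrite lerXn2r ?nnegrE ?normr_ge0 //.
    by apply: sumr_ge0 => i _; rewrite mulr_ge0 ?normr_ge0.
  by apply: (le_trans (ler_norm_sum _ _ _)); apply: ler_sum => i _; rewrite normrM.
(* Lagrange's identity *)
have lagrange : \sum_i \sum_j (x i * y j - x j * y i) ^+ 2 =
    ((\sum_i x i ^+ 2) * (\sum_i y i ^+ 2) - (\sum_i x i * y i) ^+ 2) *+ 2.
  rewrite mulrnBl.
  rewrite -[in RHS]mulr_natr !big_distrlr /= expr2 big_distrlr /=.
  transitivity (\sum_i \sum_j (x i ^+ 2 * y j ^+ 2 + x j ^+ 2 * y i ^+ 2)
     - \sum_i \sum_j (x i * y i * (x j * y j)) *+ 2).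
    rewrite -sumrB; apply: eq_bigr => i _; rewrite -sumrB; apply: eq_bigr => j _.
    rewrite sqrrB !exprMn addrAC; congr (_ - _ *+ 2).
    by rewrite [x j * y i]mulrC mulrACA [y j * _]mulrC.
  congr (_ - _).
    rewrite mulr_natr mulr2n.
    transitivity (\sum_i (\sum_j x i ^+ 2 * y j ^+ 2 + \sum_j x j ^+ 2 * y i ^+ 2)).
      by apply: eq_bigr => i _; rewrite big_split.
    by rewrite big_split /=; congr (_ + _); rewrite exchange_big.
  by rewrite -sumrMnl; apply: eq_bigr => i _; rewrite -sumrMnl.
have : 0 <= \sum_i \sum_j (x i * y j - x j * y i) ^+ 2.
  apply: sumr_ge0 => i _; apply: sumr_ge0 => j _; apply: real_exprn_even_ge0 => //.
  by rewrite rpredB // rpredM.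
by rewrite lagrange pmulrn_lge0 // subr_ge0.
Qed.

Lemma conj_mxK m n (A : 'M[C]_(m, n)) : map_mx Num.conj (map_mx Num.conj A) = A.
Proof. by apply/matrixP => i j; rewrite !mxE conjCK. Qed.

Lemma op_bounded_conj n (A : 'M[C]_n) c :
  op_bounded A c -> op_bounded (map_mx Num.conj A) c.
Proof.
move=> Ac v; have := Ac (map_mx Num.conj v); rewrite sqnorm_map_conj.
by rewrite -(sqnorm_map_conj (A *m _)) map_mxM conj_mxK.
Qed.

(** With u = A^* v, the square of |u|^2 = <A u, v> is at most |A u|^2 |v|^2,
    hence at most c^2 |u|^2 |v|^2, and one factor |u|^2 cancels. *)
Lemma op_bounded_trmx n (A : 'M[C]_n) c :
  c \is Num.real -> op_bounded A c -> op_bounded A^T c.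
Proof.
move=> cr Ac.
suff Hadj : op_bounded (map_mx Num.conj A)^T c.
  by have := op_bounded_conj Hadj; rewrite map_trmx conj_mxK.
move=> v; set u := _ *m v; set w := A *m u.
have uE : sqnorm u = \sum_j (w j 0)^* * v j 0.
  rewrite /sqnorm.
  transitivity (\sum_i \sum_j (u i 0)^* * (A j i)^* * v j 0).
    apply: eq_bigr => i _; rewrite normCKC {2}/u mxE big_distrr /=.
    by apply: eq_bigr => j _; rewrite !mxE mulrA.
  rewrite exchange_big; apply: eq_bigr => j _ /=.
  rewrite /w mxE rmorph_sum mulr_suml; apply: eq_bigr => i _.
  by rewrite rmorphM /= [(u i 0)^* * _]mulrC.
have s0 := sqnorm_ge0 u; have v0 := sqnorm_ge0 v.
have : sqnorm u ^+ 2 <= sqnorm u * (c ^+ 2 * sqnorm v).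
  rewrite -{1}(ger0_norm s0) {1}uE; apply: le_trans (cauchy_schwarz _ _) _.
  rewrite (_ : \sum_i `|(w i 0)^*| ^+ 2 = sqnorm w); last first.
    by apply: eq_bigr => i _; rewrite norm_conjC.
  by rewrite mulrA ler_wpM2r // mulrC; exact: Ac.
move: s0; rewrite le_eqVlt => /orP[/eqP <-|s0].
  by rewrite mulr_ge0 // real_exprn_even_ge0.
by rewrite expr2 ler_pM2l.
Qed.

Lemma op_bounded_reindex n (A : 'M[C]_n) c (s : 'S_n) :
  op_bounded A c -> op_bounded (\matrix_(i, j) A (s i) (s j)) c.
Proof.
move=> Ac v.
pose u : 'cV[C]_n := \col_i v (s^-1%g i) 0.
have -> : sqnorm v = sqnorm u.
  rewrite /sqnorm (reindex_inj (@perm_inj _ s^-1%g)) /=.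
  by apply: eq_bigr => i _; rewrite mxE.
apply: le_trans (Ac u); rewrite /sqnorm.
rewrite [leRHS](reindex_inj (@perm_inj _ s)) /=.
rewrite le_eqVlt; apply/orP; left; apply/eqP.
apply: eq_bigr => i _; rewrite !mxE; congr (`|_| ^+ 2).
rewrite [RHS](reindex_inj (@perm_inj _ s)) /=.
by apply: eq_bigr => j _; rewrite !mxE permK.
Qed.

End OperatorBound.

(** * Sums over constrained walks *)
Section Walks.
Variable C : numClosedFieldType.
Variable N : nat.
Implicit Types (B : nat -> 'M[C]_N) (w : nat -> 'I_N -> C).

Definition ffun_cons (T : Type) m (i : T) (f : {ffun 'I_m -> T}) :
    {ffun 'I_m.+1 -> T} :=
  [ffun k => oapp f i (unlift ord0 k)].

Lemma big_ffun_cons (T : finType) m (F : {ffun 'I_m.+1 -> T} -> C) :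
  \sum_f F f = \sum_i \sum_(f : {ffun 'I_m -> T}) F (ffun_cons i f).
Proof.
rewrite pair_big /=.
rewrite (reindex (fun q : T * {ffun 'I_m -> T} => ffun_cons q.1 q.2)) //=.
exists (fun f : {ffun 'I_m.+1 -> T} => (f ord0, [ffun k => f (lift ord0 k)])).
  move=> [i f] _ /=; rewrite ffunE unlift_none /=; congr (_, _).
  by apply/ffunP => k; rewrite !ffunE liftK.
move=> f _; apply/ffunP => k; rewrite ffunE /=.
by case: unliftP => [k' ->|->] //=; rewrite ffunE.
Qed.

Definition walk_weight m B w (psi : {ffun 'I_m.+1 -> 'I_N}) : C :=
  (\prod_(a < m.+1) w a (psi a)) *
  \prod_(t < m) B t (psi (widen_ord (leqnSn m) t)) (psi (lift ord0 t)).

Lemma walk_weight_cons m B w i (psi : {ffun 'I_m.+1 -> 'I_N}) :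
  walk_weight B w (ffun_cons i psi) =
  w 0%N i * B 0%N i (psi ord0) *
    walk_weight (fun t => B t.+1) (fun a => w a.+1) psi.
Proof.
rewrite /walk_weight big_ord_recl ffunE unlift_none /=.
rewrite [X in _ * X = _]big_ord_recl.
under eq_bigr do rewrite ffunE liftK /=.
rewrite [X in _ * (X * _) = _](_ : _ = B 0%N i (psi ord0)); last first.
  congr (B _ _ _); rewrite ffunE ?liftK //.
  by rewrite (_ : widen_ord _ _ = ord0) ?unlift_none //; apply: val_inj.
rewrite mulrACA -!mulrA; congr (_ * (_ * (_ * _))).
apply: eq_bigr => t _; congr (B _ _ _); rewrite ffunE ?liftK //.
rewrite (_ : widen_ord _ _ = lift ord0 (widen_ord (leqnSn m) t)) ?liftK //.
exact: val_inj.
Qed.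

(** The sum over all walks is the inner product of the constant vector 1 with
    W_0 B_0 W_1 B_1 ... W_m 1, where W_a is the diagonal matrix of the weights
    at time a; [walk_vec] is the vector on the right. *)
Definition walk_vec m B w : 'cV[C]_N :=
  \col_j \sum_(psi : {ffun 'I_m.+1 -> 'I_N} | psi ord0 == j) @walk_weight m B w psi.

Lemma walk_vecS m B w : walk_vec m.+1 B w =
  \col_j (w 0%N j * (B 0%N *m walk_vec m (fun t => B t.+1) (fun a => w a.+1)) j 0).
Proof.
apply/matrixP => j k; rewrite !mxE {k}.
rewrite big_mkcond big_ffun_cons (bigD1 j) //= [X in _ + X]big1 ?addr0; last first.
  move=> i ij; rewrite big1 // => psi _.
  by rewrite ffunE unlift_none /= (negPf ij).
under eq_bigr do rewrite ffunE unlift_none /= eqxx walk_weight_cons -mulrA.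
rewrite -big_distrr /=; congr (_ * _).
rewrite (partition_big (fun psi : {ffun 'I_m.+1 -> 'I_N} => psi ord0) predT) //=.
apply: eq_bigr => i _; rewrite mxE big_distrr /=.
by apply: eq_bigr => psi /eqP ->.
Qed.

Lemma sqnorm_walk_vec m B w c : c \is Num.real ->
  (forall t, (t < m)%N -> op_bounded (B t) c) ->
  (forall a i, `|w a i| <= 1) ->
  sqnorm (walk_vec m B w) <= (c ^+ 2) ^+ m * N%:R.
Proof.
move=> c0; elim: m B w => [|m IH] B w Bc w1.
  rewrite mul1r -[N in N%:R]card_ord -sumr_const; apply: ler_sum => i _.
  rewrite mxE exprn_ile1 // big_mkcond big_ffun_cons (bigD1 i) //=.
  rewrite [X in _ + X]big1 ?addr0 => [|j ji]; last first.
    by rewrite big1 // => f _; rewrite ffunE unlift_none /= (negPf ji).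
  rewrite (eq_bigr (fun=> w 0%N i)) => [|f _].
    by rewrite sumr_const card_ffun !card_ord expn0; exact: w1.
  by rewrite /walk_weight big_ord1 big_ord0 mulr1 !ffunE unlift_none /= eqxx.
rewrite walk_vecS; set v := walk_vec _ _ _.
apply: (@le_trans _ _ (sqnorm (B 0%N *m v))).
  apply: ler_sum => i _; rewrite mxE normrM exprMn ler_piMl ?exprn_ge0 //.
  by rewrite exprn_ile1.
apply: le_trans (Bc 0%N isT v) _.
rewrite [(c ^+ 2) ^+ _]exprS -mulrA ler_wpM2l ?real_exprn_even_ge0 //.
by apply: IH => [t tm|a i]; [exact: Bc|exact: w1].
Qed.

(** Both the constant vector and [walk_vec] have norm of order the square root
    of N, which gives one factor N. *)
Lemma norm_walk_sum m B w c : 0 <= c ->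
  (forall t, (t < m)%N -> op_bounded (B t) c) ->
  (forall a i, `|w a i| <= 1) ->
  `|\sum_psi @walk_weight m B w psi| <= c ^+ m * N%:R.
Proof.
move=> c0 Bc w1.
have -> : \sum_psi @walk_weight m B w psi = \sum_j 1 * walk_vec m B w j 0.
  rewrite (partition_big (fun psi : {ffun 'I_m.+1 -> 'I_N} => psi ord0) predT) //=.
  by apply: eq_bigr => j _; rewrite mul1r mxE.
rewrite -(@ler_pXn2r _ 2) ?nnegrE ?mulr_ge0 ?exprn_ge0 //.
apply: le_trans (cauchy_schwarz _ _) _.
under eq_bigr do rewrite normr1 expr1n.
rewrite sumr_const card_ord exprMn -exprM mulnC exprM expr2 mulrA mulrC.
rewrite ler_wpM2r //; apply: sqnorm_walk_vec => //; exact: ger0_real.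
Qed.

(** A uniform choice of independent signs, one for each index, turns the
    indicator of i = j into the expectation of a product of a function of i and
    a function of j. *)
Definition signs_at (u : {ffun 'I_N -> bool}) (i : 'I_N) : C := (-1) ^+ u i.

Lemma sign_orthogonality (i j : 'I_N) :
  \sum_u signs_at u i * signs_at u j = (2 ^ N)%:R * (i == j)%:R.
Proof.
have [<-|ij] := eqVneq i j.
  rewrite mulr1 (eq_bigr (fun=> 1)) => [|u _]; last first.
    by rewrite /signs_at -expr2 sqrr_sign.
  by rewrite sumr_const card_ffun card_bool card_ord.
rewrite mulr0; pose flip (u : {ffun 'I_N -> bool}) := [ffun k => u k (+) (k == i)].
have flipK : involutive flip.
  by move=> u; apply/ffunP => k; rewrite !ffunE addbK.
set S := LHS; have : S = - S.
  rewrite {1}/S (reindex_inj (inv_inj flipK)) /= -sumrN; apply: eq_bigr => u _.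
  rewrite /signs_at !ffunE eqxx [j == i]eq_sym (negPf ij) addbF addbT.
  by rewrite signrN mulNr.
by move/eqP; rewrite -addr_eq0 -mulr2n mulrn_eq0 => /eqP.
Qed.

Definition constraint_holds m (c : 'I_m.+1 * 'I_m.+1 * bool)
    (psi : {ffun 'I_m.+1 -> 'I_N}) : bool :=
  (psi c.1.1 == psi c.1.2) == c.2.

Lemma walk_weight_mulw m B w (a : 'I_m.+1) (u : 'I_N -> C)
    (psi : {ffun 'I_m.+1 -> 'I_N}) :
  u (psi a) * @walk_weight m B w psi =
  walk_weight B (fun b i => (if b == a then u i else 1) * w b i) psi.
Proof.
rewrite /walk_weight mulrA; congr (_ * _).
rewrite big_split /= [X in _ = X * _](bigD1 a) //= eqxx.
rewrite [X in _ = _ * X * _]big1 ?mulr1 //.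
by move=> b ba; rewrite (_ : (b == a :> nat) = (b == a)) // (negPf ba).
Qed.

(** Equality of two positions of the walk is an average of vertex weights of
    modulus 1 at these positions, so that it does not affect the bound;
    distinctness is 1 minus equality and costs a factor 2. *)
Lemma norm_constrained_walk_sum m B w c (cs : seq ('I_m.+1 * 'I_m.+1 * bool)) :
  0 <= c ->
  (forall t, (t < m)%N -> op_bounded (B t) c) ->
  (forall a i, `|w a i| <= 1) ->
  `|\sum_psi (\prod_(k <- cs) (constraint_holds k psi)%:R) *
      @walk_weight m B w psi| <= 2 ^+ size cs * (c ^+ m * N%:R).
Proof.
move=> c0 Bc; elim: cs w => [|[[a b] e] cs IH] w w1 /=.
  by under eq_bigr do rewrite big_nil mul1r; rewrite mul1r; exact: norm_walk_sum.
pose F w (psi : {ffun 'I_m.+1 -> 'I_N}) : C := (\prod_(k <- cs) (constraint_holds k psi)%:R) *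
      @walk_weight m B w psi.
set M := 2 ^+ size cs * (c ^+ m * N%:R) in IH *.
have eqb : `|\sum_(psi : {ffun 'I_m.+1 -> 'I_N}) (psi a == psi b)%:R * F w psi| <= M.
  pose wu u k i : C := (if k == b :> nat then signs_at u i else 1) *
     ((if k == a :> nat then signs_at u i else 1) * w k i).
  have key : (2 ^ N)%:R * (\sum_(psi : {ffun 'I_m.+1 -> 'I_N}) (psi a == psi b)%:R * F w psi) =
      \sum_u \sum_psi F (wu u) psi.
    rewrite exchange_big big_distrr /=; apply: eq_bigr => psi _.
    rewrite mulrA -sign_orthogonality big_distrl /=; apply: eq_bigr => u _.
    rewrite /F /wu -!walk_weight_mulw mulrCA -!mulrA; congr (_ * _).
    by rewrite mulrCA; congr (_ * _); rewrite mulrCA.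
  have N0 : 0 < (2 ^ N)%:R :> C by rewrite ltr0n expn_gt0.
  rewrite -(ler_pM2l N0) -{1}(ger0_norm (ltW N0)) -normrM key.
  apply: (le_trans (ler_norm_sum _ _ _)).
  have -> : (2 ^ N)%:R * M = \sum_(u : {ffun 'I_N -> bool}) M.
    by rewrite sumr_const card_ffun card_bool card_ord mulr_natl.
  apply: ler_sum => u _; apply: IH => k i; rewrite /wu !normrM.
  by case: ifP => _; case: ifP => _; rewrite ?normr1 ?mul1r // /signs_at normr_sign ?mul1r.
have M0 : 0 <= M by rewrite !mulr_ge0 ?exprn_ge0.
rewrite exprS -mulrA -/M mulr_natl mulr2n.
under eq_bigr do rewrite big_cons -mulrA -/(F w _).
case: e.
  under eq_bigr do rewrite /constraint_holds eqb_id.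
  by apply: le_trans eqb _; rewrite lerDl.
rewrite (eq_bigr (fun psi => F w psi - (psi a == psi b)%:R * F w psi)); last first.
  by move=> psi _; rewrite /constraint_holds eqbF_neg /=; case: eqP => _;
    rewrite ?mul0r ?mul1r ?subrr ?subr0.
rewrite sumrB; apply: le_trans (ler_normB _ _) _; apply: lerD => //.
exact: IH.
Qed.

End Walks.

(** * Nets *)
Section Nets.
Variables (L : nat) (K : Type).

(** A net is a graph monomial enriched so as to be closed under products,
    adjoints and centering: an edge may carry the complex conjugate of its
    matrix, and a constraint (u, v, e) restricts the sum to the maps that
    identify u and v if e holds, and separate them otherwise. Equality
    constraints replace the identification of vertices, so that no quotient type
    is needed. *)
Record net := Net {
  net_vertex : finType;
  net_edge : finType;
  net_src : net_edge -> net_vertex;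
  net_tgt : net_edge -> net_vertex;
  net_in : net_vertex;
  net_out : net_vertex;
  net_family : net_edge -> 'I_L;
  net_index : net_edge -> K;
  net_conj : net_edge -> bool;
  net_cons : seq (net_vertex * net_vertex * bool) }.

Definition compatible (n : net) (X : eqType) (f : net_vertex n -> X) : bool :=
  all (fun c => (f c.1.1 == f c.1.2) == c.2) (net_cons n).

Definition net_of_graph (g : graph_monomial L K) : net :=
  @Net (gm_vertex g) (gm_edge g) (@gm_src _ _ g) (@gm_tgt _ _ g)
    (gm_in g) (gm_out g) (@gm_family _ _ g) (@gm_index _ _ g) (fun=> false) [::].

Definition net_one : net :=
  @Net unit void (fun=> tt) (fun=> tt) tt tt
    (of_void _) (of_void _) (of_void _) [::].

Definition net_var (l : 'I_L) (k : K) : net :=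
  @Net bool unit (fun=> true) (fun=> false) true false
    (fun=> l) (fun=> k) (fun=> false) [::].

Definition net_mul (n1 n2 : net) : net :=
  @Net (net_vertex n1 + net_vertex n2)%type (net_edge n1 + net_edge n2)%type
    (fun e => match e with inl e => inl (net_src e) | inr e => inr (net_src e) end)
    (fun e => match e with inl e => inl (net_tgt e) | inr e => inr (net_tgt e) end)
    (inr (net_in n2)) (inl (net_out n1))
    (fun e => match e with inl e => net_family e | inr e => net_family e end)
    (fun e => match e with inl e => net_index e | inr e => net_index e end)
    (fun e => match e with inl e => net_conj e | inr e => net_conj e end)
    ((inl (net_in n1), inr (net_out n2), true) ::
      [seq (inl c.1.1, inl c.1.2, c.2) | c <- net_cons n1] ++
      [seq (inr c.1.1, inr c.1.2, c.2) | c <- net_cons n2]).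

(** The edges keep their direction: conjugating all entries and exchanging the
    roots is enough. *)
Definition net_adj (n : net) : net :=
  @Net (net_vertex n) (net_edge n) (@net_src n) (@net_tgt n)
    (net_out n) (net_in n) (@net_family n) (@net_index n)
    (fun e => ~~ net_conj e) (net_cons n).

(** With [true] this is the diagonal part, with [false] the centered matrix. *)
Definition net_constrain (b : bool) (n : net) : net :=
  @Net (net_vertex n) (net_edge n) (@net_src n) (@net_tgt n)
    (net_in n) (net_out n) (@net_family n) (@net_index n)
    (@net_conj n) ((net_in n, net_out n, b) :: net_cons n).

Definition net_monomial (l : 'I_L) (Q : bmonomial (graph_monomial L K) K) : net :=
  net_mul (net_of_graph (bm_coef Q ord0))
    (\big[net_mul/net_one]_(j < bm_degree Q)
       net_mul (net_var l (bm_var Q j)) (net_of_graph (bm_coef Q (lift ord0 j)))).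

Lemma compatible_mul n1 n2 (X : eqType) (f : net_vertex (net_mul n1 n2) -> X) :
  compatible f = [&& f (inl (net_in n1)) == f (inr (net_out n2)),
    compatible (fun v : net_vertex n1 => f (inl v)) &
    compatible (fun v : net_vertex n2 => f (inr v))].
Proof. by rewrite /compatible /= all_cat !all_map eqb_id. Qed.

Lemma compatible_constrain b n (X : eqType)
    (f : net_vertex (net_constrain b n) -> X) :
  compatible f = ((f (net_in n) == f (net_out n)) == b) && @compatible n X f.
Proof. by []. Qed.

Section Evaluation.
Variables (C : numClosedFieldType) (N : nat) (A : 'I_L -> K -> 'M[C]_N).

Definition net_matrix n (e : net_edge n) : 'M[C]_N :=
  let M := A (net_family e) (net_index e) in
  if net_conj e then map_mx Num.conj M else M.

Definition net_weight n (phi : net_vertex n -> 'I_N) : C :=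
  \prod_(e : net_edge n) net_matrix e (phi (net_tgt e)) (phi (net_src e)).

Definition net_eval n : 'M[C]_N :=
  \matrix_(i, j) \sum_(phi : {ffun net_vertex n -> 'I_N} |
    [&& phi (net_in n) == j, phi (net_out n) == i & compatible phi])
      net_weight phi.

Lemma net_eval_graph g : net_eval (net_of_graph g) = gm_eval A g.
Proof. by apply/matrixP => i j; rewrite !mxE; apply: eq_bigl => phi; rewrite andbT. Qed.

Lemma net_eval_one : net_eval net_one = 1.
Proof.
apply/matrixP => i j; rewrite !mxE.
rewrite (reindex (fun i : 'I_N => [ffun=> i] : {ffun unit -> 'I_N})) /=; last first.
  by exists (fun phi => phi tt) => [x _|phi _]; [rewrite ffunE|
    apply/ffunP => -[]; rewrite ffunE].
under eq_bigl => x do rewrite !ffunE andbT.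
under eq_bigr => x _ do rewrite /net_weight big_pred0 //.
rewrite big_mkcondl /= (big_pred1_eq _ i) eq_sym.
by rewrite /compatible /=; case: eqP.
Qed.

Lemma net_eval_var l k : net_eval (net_var l k) = A l k.
Proof.
apply/matrixP => i j; rewrite mxE.
rewrite (big_pred1 [ffun b => if b then j else i]).
  by rewrite /net_weight (big_pred1 tt) => [|[]] //; rewrite /net_matrix /= !ffunE.
move=> phi; rewrite /= andbT; apply/andP/eqP.
  by case=> /eqP pj /eqP pi; apply/ffunP => -[]; rewrite ffunE.
by move=> ->; rewrite !ffunE.
Qed.

Lemma net_eval_mul n1 n2 :
  net_eval (net_mul n1 n2) = net_eval n1 *m net_eval n2.
Proof.
apply/matrixP => i j; rewrite !mxE.
pose glue (q : {ffun net_vertex n1 -> 'I_N} * {ffun net_vertex n2 -> 'I_N}) :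
    {ffun net_vertex (net_mul n1 n2) -> 'I_N} :=
  [ffun v => match v with inl v => q.1 v | inr v => q.2 v end].
rewrite (reindex glue) /=; last first.
  exists (fun phi => ([ffun v => phi (inl v)], [ffun v => phi (inr v)])).
    by move=> [q1 q2] _; congr (_, _); apply/ffunP => v; rewrite !ffunE.
  by move=> phi _; apply/ffunP => -[] v; rewrite !ffunE.
rewrite (partition_big (fun q : {ffun net_vertex n1 -> 'I_N} *
  {ffun net_vertex n2 -> 'I_N} => q.1 (net_in n1)) predT) //=.
apply: eq_bigr => k _; rewrite !mxE big_distrlr /= pair_big /=.
apply: eq_big => [[q1 q2]|[q1 q2] _] /=.
  rewrite compatible_mul !ffunE /=.
  rewrite (_ : compatible (fun v => glue _ (inl v)) = compatible q1); last first.
    by apply: eq_all => c; rewrite !ffunE.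
  rewrite (_ : compatible (fun v => glue _ (inr v)) = compatible q2); last first.
    by apply: eq_all => c; rewrite !ffunE.
  have [->|] := eqVneq (q1 (net_in n1)) k; last by rewrite andbF.
  rewrite andbT [k == _]eq_sym.
  by do !case: (_ == _) => //=; rewrite ?andbF //; case: (compatible _).
rewrite /net_weight big_sumType /=.
by congr (_ * _); apply: eq_bigr => e _; rewrite !ffunE.
Qed.

Lemma net_eval_adj n i j : net_eval (net_adj n) i j = (net_eval n j i)^*.
Proof.
rewrite !mxE rmorph_sum; apply: eq_big => [phi|phi _] /=.
  by rewrite andbCA.
rewrite /net_weight rmorph_prod; apply: eq_bigr => e _.
by rewrite /net_matrix /=; case: net_conj; rewrite /= ?mxE ?conjCK.
Qed.

Lemma net_eval_constrain b n i j :
  net_eval (net_constrain b n) i j = net_eval n i j *+ ((i == j) == b).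
Proof.
rewrite !mxE; case: eqP => [ijb|ijb]; last first.
  rewrite big_pred0 // => phi; rewrite compatible_constrain /=.
  apply/negP => /and3P[/eqP pj /eqP pi /andP[/eqP]].
  by rewrite eq_sym pi pj.
apply: eq_bigl => phi; rewrite compatible_constrain /=.
have [->|//] := eqVneq (phi (net_in n)) j.
have [->|//] := eqVneq (phi (net_out n)) i.
by rewrite [j == i]eq_sym ijb eqxx.
Qed.

Lemma net_eval_prod m (F : 'I_m -> net) :
  net_eval (\big[net_mul/net_one]_(i < m) F i) = \prod_(i < m) net_eval (F i).
Proof.
by apply: (big_morph net_eval); [exact: net_eval_mul|exact: net_eval_one].
Qed.

Lemma net_eval_monomial l Q : net_eval (net_monomial l Q) =
  bm_subst (A l) (bm_map (gm_eval A) Q).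
Proof.
rewrite net_eval_mul net_eval_graph net_eval_prod; congr (_ * _).
by apply: eq_bigr => j _; rewrite net_eval_mul net_eval_graph net_eval_var.
Qed.

Lemma net_eval_centered n : net_eval (net_constrain false n) = centered (net_eval n).
Proof.
apply/matrixP => i j; rewrite net_eval_constrain !mxE.
by case: (i == j); rewrite ?subr0 ?subrr.
Qed.

Lemma net_eval_diag n : net_eval (net_constrain true n) = diag_part (net_eval n).
Proof. by apply/matrixP => i j; rewrite net_eval_constrain !mxE eqb_id. Qed.

Lemma trace_net_eval n : \tr (net_eval n) =
  \sum_(phi : {ffun net_vertex n -> 'I_N} |
     @compatible (net_constrain true n) _ phi) net_weight phi.
Proof.
rewrite /mxtrace (partition_big (fun phi : {ffun net_vertex n -> 'I_N} =>
  phi (net_out n)) predT) //=.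
apply: eq_bigr => i _; rewrite mxE; apply: eq_bigl => phi.
rewrite compatible_constrain /= eqb_id.
have [->|] := eqVneq (phi (net_out n)) i; last by rewrite !andbF.
by rewrite andbT.
Qed.

End Evaluation.

(** * Connectivity, parity and splitting of nets *)

Section Structure.
Variable n : net.

(** The position of the end x of an edge of colour c once the vertex x0 has been
    split in two halves: the edges of colour l at x0 are moved to (x0, true),
    and all other points x become (x, false). *)
Definition split_at (X : eqType) (x0 : X) (l c : 'I_L) (x : X) : X * bool :=
  (x, (x == x0) && (c == l)).

Section Along.
Variables (X : finType) (f : net_vertex n -> X).

Definition image_src e := f (net_src e).
Definition image_tgt e := f (net_tgt e).
Definition split_src x0 l (e : net_edge n) := split_at x0 l (net_family e) (image_src e).
Definition split_tgt x0 l (e : net_edge n) := split_at x0 l (net_family e) (image_tgt e).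

End Along.

(** The properties below are asked in every quotient of the net that respects
    its constraints, a quotient being given as a map f from the vertices. *)
Definition net_connected : Prop := forall (X : finType) (f : net_vertex n -> X),
  compatible f -> forall u v, linked (image_src f) (image_tgt f) (f u) (f v).

Definition net_even : Prop := forall (X : finType) (f : net_vertex n -> X),
  compatible f -> forall x : X,
  odd (degree (image_src f) (image_tgt f) setT x) =
    (f (net_in n) == x) (+) (f (net_out n) == x).

(** What a path of edges of colour [c] from the input to the output provides in
    every splitting: at a split vertex such a path stays on one side. *)
Definition joins_roots (c : 'I_L) : Prop := forall (X : finType) (f : net_vertex n -> X),
  compatible f -> forall x0 l,
  linked (split_src f x0 l) (split_tgt f x0 l)
    (split_at x0 l c (f (net_in n))) (split_at x0 l c (f (net_out n))).

Definition splittable : Prop := forall (X : finType) (f : net_vertex n -> X),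
  compatible f -> exists x0 l,
  linked (split_src f x0 l) (split_tgt f x0 l) (x0, true) (x0, false).

End Structure.

Lemma linked_sub (Y E1 E2 : Type) (s1 t1 : E1 -> Y) (s2 t2 : E2 -> Y)
    (h : E1 -> E2) a b :
  (forall e, s1 e = s2 (h e)) -> (forall e, t1 e = t2 (h e)) ->
  linked s1 t1 a b -> linked s2 t2 a b.
Proof. by move=> hs ht ab U Ue; apply: ab => e; rewrite hs ht. Qed.

Lemma net_connected_mul n1 n2 : net_connected n1 -> net_connected n2 ->
  net_connected (net_mul n1 n2).
Proof.
move=> c1 c2 X f; rewrite compatible_mul => /and3P[/eqP f12 f1 f2].
have l1 u v : linked (image_src f) (image_tgt f) (f (inl u)) (f (inl v)).
  exact: (linked_sub (h := inl)) (c1 _ _ f1 u v).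
have l2 u v : linked (image_src f) (image_tgt f) (f (inr u)) (f (inr v)).
  exact: (linked_sub (h := inr)) (c2 _ _ f2 u v).
have l12 u v : linked (image_src f) (image_tgt f) (f (inl u)) (f (inr v)).
  by apply: linked_trans (l1 u (net_in n1)) _; rewrite f12; exact: l2.
by move=> [u|u] [v|v] //; apply: linked_sym; exact: l12.
Qed.

Lemma degree_mul n1 n2 (X : finType) (f : net_vertex (net_mul n1 n2) -> X) x :
  degree (image_src f) (image_tgt f) setT x =
  (degree (@image_src n1 _ (fun v => f (inl v))) (image_tgt (fun v => f (inl v))) setT x +
   degree (@image_src n2 _ (fun v => f (inr v))) (image_tgt (fun v => f (inr v))) setT x)%N.
Proof.
rewrite /degree (eq_bigl xpredT) ?big_sumType /=; last by move=> e; rewrite inE.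
by congr (_ + _)%N; apply: eq_bigl => e; rewrite inE.
Qed.

Lemma net_even_mul n1 n2 : net_even n1 -> net_even n2 -> net_even (net_mul n1 n2).
Proof.
move=> e1 e2 X f; rewrite compatible_mul => /and3P[/eqP f12 f1 f2] x.
rewrite degree_mul oddD (e1 _ _ f1) (e2 _ _ f2) /= f12.
by case: (f (inr (net_out n2)) == x); case: (f (inl (net_out n1)) == x);
  case: (f (inr (net_in n2)) == x).
Qed.

Lemma joins_roots_mul n1 n2 c : joins_roots n1 c -> joins_roots n2 c ->
  joins_roots (net_mul n1 n2) c.
Proof.
move=> c1 c2 X f; rewrite compatible_mul => /and3P[/eqP f12 f1 f2] x0 l.
apply: (@linked_trans _ _ _ _ (split_at x0 l c (f (inr (net_out n2))))).
  exact: (linked_sub (h := inr)) (c2 _ _ f2 x0 l).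
by rewrite -f12; exact: (linked_sub (h := inl)) (c1 _ _ f1 x0 l).
Qed.

Lemma splittable_mull n1 n2 : splittable n1 -> splittable (net_mul n1 n2).
Proof.
move=> s1 X f; rewrite compatible_mul => /and3P[_ f1 _].
have [x0 [l h]] := s1 _ _ f1; exists x0, l.
exact: (linked_sub (h := inl)) h.
Qed.

Lemma net_connected_one : net_connected net_one.
Proof. by move=> X f _ [] []. Qed.

Lemma net_even_one : net_even net_one.
Proof.
by move=> X f _ x; rewrite addbb /degree big1 // => -[].
Qed.

Lemma net_connected_var l k : net_connected (net_var l k).
Proof.
move=> X f _; have e := @linked_edge _ _ (@image_src (net_var l k) _ f) (image_tgt f) tt.
by move=> [] [] //; apply: linked_sym.
Qed.

Lemma net_even_var l k : net_even (net_var l k).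
Proof.
move=> X f _ x; rewrite /degree (big_pred1 tt) => [|[]]; last by rewrite inE.
by rewrite /incidence oddD !oddb.
Qed.

Lemma joins_roots_var l k : joins_roots (net_var l k) l.
Proof. by move=> X f _ x0 l'; exact: (@linked_edge _ _ _ _ tt). Qed.

Lemma net_connected_prod m (F : 'I_m -> net) : (forall i, net_connected (F i)) ->
  net_connected (\big[net_mul/net_one]_(i < m) F i).
Proof.
by move=> h; apply: big_ind => //; [exact: net_connected_one|exact: net_connected_mul].
Qed.

Lemma net_even_prod m (F : 'I_m -> net) : (forall i, net_even (F i)) ->
  net_even (\big[net_mul/net_one]_(i < m) F i).
Proof.
by move=> h; apply: big_ind => //; [exact: net_even_one|exact: net_even_mul].
Qed.

Lemma joins_roots_prod m (F : 'I_m -> net) c : (forall i, joins_roots (F i) c) ->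
  joins_roots (\big[net_mul/net_one]_(i < m) F i) c.
Proof.
move=> h; apply: (big_ind (fun n => joins_roots n c)) => //.
by move=> n1 n2; exact: joins_roots_mul.
Qed.

Lemma net_even_adj n : net_even n -> net_even (net_adj n).
Proof. by move=> h X f fc x; rewrite addbC; exact: h. Qed.

Lemma net_connected_constrain b n : net_connected n -> net_connected (net_constrain b n).
Proof. by move=> h X f /andP[_]; exact: h. Qed.

Lemma net_even_constrain b n : net_even n -> net_even (net_constrain b n).
Proof. by move=> h X f /andP[_]; exact: h. Qed.

Lemma net_connected_graph g : net_connected (net_of_graph g).
Proof.
move=> X f _ u v U Ue.
pose r x y := [exists e : gm_edge g,
  ((gm_src e, gm_tgt e) == (x, y)) || ((gm_src e, gm_tgt e) == (y, x))].
suff cl : closed r [pred w | U (f w)] by exact: (closed_connect cl (gm_connected u v)).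
move=> x y /existsP[e /orP[]/eqP[<- <-]]; rewrite !inE; first exact: Ue.
by rewrite -[LHS]/(U (image_tgt f e)) -Ue.
Qed.

(** Around a closed walk each visited vertex is the end of two steps. *)
Lemma cycle_even (X : finType) (g : graph_monomial L K)
    (f : net_vertex (net_of_graph g) -> X) (Z : {set gm_edge g}) x : simple_cycle Z ->
  ~~ odd (\sum_(e in Z) incidence (image_src f) (image_tgt f) x e).
Proof.
case=> -[|a p] [// _ cyc _ up ->].
pose J (e : gm_edge g) v w :=
  ((gm_src e, gm_tgt e) == (v, w)) || ((gm_src e, gm_tgt e) == (w, v)).
rewrite (eq_bigl (mem (unzip2 (a :: p)))) => [|e]; last by rewrite inE.
rewrite -big_uniq // big_map.
have key b q : path (fun a b => J a.2 a.1 b.1) b q ->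
    odd (\sum_(d <- belast b q) incidence (image_src f) (image_tgt f) x d.2)
    = (f b.1 == x) (+) (f (last b q).1 == x).
  elim: q b => [|d q IH] b /=; first by rewrite big_nil addbb.
  case/andP=> bd dq; rewrite big_cons oddD IH // addbA; congr (_ (+) _).
  rewrite /incidence oddD !oddb /image_src /image_tgt /=.
  by move: bd => /orP[]/eqP[-> ->]; case: (f d.1 == x); case: (f b.1 == x).
have := key a (rcons p a) cyc; rewrite belast_rcons last_rcons addbb => ->.
by [].
Qed.

(** The edges of a cactus are partitioned by its simple cycles. *)
Lemma net_even_cactus g : cactus_type g -> net_even (net_of_graph g).
Proof.
case=> -[cac _] inout X f _ x; rewrite /= inout addbb.
have [Zf ZfP] : exists Zf : gm_edge g -> {set gm_edge g}, forall e,
    unique (fun Z => simple_cycle Z /\ e \in Z) (Zf e).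
  by have [h hP] := boolp.choice cac; exists h.
apply/negbTE; rewrite /degree (eq_bigl xpredT) => [|e]; last by rewrite inE.
rewrite (partition_big Zf xpredT) //=.
apply: (big_ind (fun k => ~~ odd k)) => // [k1 k2 h1 h2|Z _].
  by rewrite oddD (negPf h1) (negPf h2).
case: (pickP (fun e => Zf e == Z)) => [e0 /eqP Z0|none]; last first.
  by rewrite big_pred0.
have [[cycZ _] _] := ZfP e0; rewrite Z0 in cycZ.
rewrite (eq_bigl (mem Z)); first exact: cycle_even.
move=> e /=; have [[_ eZ] uniqZ] := ZfP e; apply/eqP/idP => [<- //|eZ'].
exact: uniqZ.
Qed.

Lemma joins_roots_graph g c : gm_in g = gm_out g -> joins_roots (net_of_graph g) c.
Proof. by move=> gio X f _ x0 l; rewrite /= gio. Qed.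

End Nets.

(** * Alternating products *)
Section Alternation.
Variables (L : nat) (K : Type).
Local Notation net := (net L K).
Local Notation net_one := (@net_one L K).

(** The points v_0, ..., v_m where a product of m centered factors passes from
    one factor to the next: consecutive points differ because the factors are
    centered, and are linked by edges of the colour of the factor between them. *)
Definition main_walk (n : net) m (c : 'I_m -> 'I_L) : Prop :=
  forall (X : finType) (f : net_vertex n -> X), compatible f ->
  exists v : nat -> X, [/\ v 0%N = f (net_out n), v m = f (net_in n) &
    forall i : 'I_m, v i != v i.+1 /\ forall x0 l,
      linked (split_src f x0 l) (split_tgt f x0 l) (split_at x0 l (c i) (v i))
        (split_at x0 l (c i) (v i.+1))].

Lemma main_walk_mul n1 n2 m (c : 'I_m.+1 -> 'I_L) :
  joins_roots n1 (c ord0) -> main_walk n2 (fun i => c (lift ord0 i)) ->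
  main_walk (net_mul (net_constrain false n1) n2) c.
Proof.
move=> c1 w2 X f; rewrite compatible_mul compatible_constrain.
move=> /and3P[/eqP f12 /andP[f1ne f1] f2].
have [v [v0 vm vs]] := w2 _ _ f2.
exists (fun k => if k is k'.+1 then v k' else f (inl (net_out n1))); split=> // i.
have [i' ->|->] := unliftP ord0 i.
  have [v1 v2] := vs i'; split=> // x0 l.
  exact: (linked_sub (h := inr)) (v2 x0 l).
rewrite /= v0 -f12; split=> [|x0 l].
  by move: f1ne; rewrite eqbF_neg eq_sym.
apply: linked_sym.
exact: (linked_sub (h := inl)) (c1 _ (fun v => f (inl v)) f1 x0 l).
Qed.

Lemma main_walk_prod m (F : 'I_m -> net) (c : 'I_m -> 'I_L) :
  (forall i, joins_roots (F i) (c i)) ->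
  main_walk (\big[@net_mul L K/net_one]_(i < m) net_constrain false (F i)) c.
Proof.
elim: m F c => [|m IH] F c Fc.
  rewrite big_ord0 => X f _; exists (fun=> f tt); split=> // -[] //.
rewrite big_ord_recl; apply: main_walk_mul => //.
by apply: IH => i; exact: Fc.
Qed.

(** Once the output and the input are identified, the main walk comes back to a
    point seen before; let t be the first time this happens and s the time of
    the first visit, so that v_s, ..., v_{t-1} are distinct. Split x0 = v_{s+1}
    along the colour of the step from v_s. The closed walk v_s, ..., v_t leaves
    x0 on the side of that colour towards v_s, on the other side towards
    v_{s+2}, and does not meet x0 in between: the two halves stay connected
    around it. *)
Lemma main_walk_splittable (n : net) m (c : 'I_m -> 'I_L) : (2 <= m)%N ->
  (forall i j : 'I_m, j = i.+1 :> nat -> c i != c j) ->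
  main_walk n c -> splittable (net_constrain true n).
Proof.
move=> m2 alt w X f; rewrite compatible_constrain eqb_id => /andP[/eqP fio fc].
have [v [v0 vm vs]] := w _ _ fc.
pose rep t := [exists s : 'I_t, v s == v t].
have : exists t, rep t && (t <= m)%N.
  exists m; rewrite leqnn andbT; apply/existsP.
  have m0 : (0 < m)%N by exact: leq_trans m2.
  by exists (Ordinal m0); rewrite /= v0 vm fio.
case/ex_minnP => t /andP[/existsP[s /eqP vst] tm] tmin.
have inj i j : (i < j)%N -> (j < t)%N -> v i != v j.
  move=> ij jt; apply/negP => vij.
  suff : (t <= j)%N by rewrite leqNgt jt.
  apply: tmin; rewrite (ltnW (leq_trans jt tm)) andbT.
  by apply/existsP; exists (Ordinal ij).
have st := ltn_ord s.
have s1t : (s.+1 < t)%N.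
  rewrite ltn_neqAle st andbT; apply/eqP => s1t.
  have sm : (s < m)%N by exact: leq_trans st tm.
  by have [+ _] := vs (Ordinal sm); rewrite /= vst s1t eqxx.
have sm : (s < m)%N by exact: leq_trans st tm.
have s1m : (s.+1 < m)%N by exact: leq_trans s1t tm.
pose i0 := Ordinal sm; pose i1 := Ordinal s1m.
pose x0 := v s.+1; exists x0, (c i0).
have vx0 j : (s.+2 <= j)%N -> (j <= t)%N -> v j != x0.
  move=> sj; rewrite leq_eqVlt => /orP[/eqP ->|jt].
    by rewrite -vst; exact: inj.
  by rewrite eq_sym; apply: inj.
have splitF j i : v j != x0 -> split_at x0 (c i0) (c i) (v j) = (v j, false).
  by rewrite /split_at => /negPf ->.
set lk := linked _ _.
have step i : lk (split_at x0 (c i0) (c i) (v i)) (split_at x0 (c i0) (c i) (v i.+1)).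
  by have [_] := vs i; exact.
have goto j : (s.+2 <= j)%N -> (j <= t)%N -> lk (x0, false) (v j, false).
  elim: j => // j IH; rewrite leq_eqVlt => /orP[/eqP sj|sj] jt.
    have := step i1; rewrite /= {1}/split_at eqxx /=.
    by rewrite eq_sym (negPf (alt i0 i1 _)) //= splitF ?vx0 // sj.
  have jm : (j < m)%N by exact: leq_trans jt tm.
  apply: linked_trans (IH sj (ltnW jt)) _.
  have := step (Ordinal jm); rewrite /= !splitF //; apply: vx0 => //.
    exact: ltnW.
  exact: ltnW.
apply: (@linked_trans _ _ _ _ (v s, false)).
  apply: linked_sym; have := step i0; rewrite /= splitF; last exact: inj.
  by rewrite /split_at !eqxx.
by apply: linked_sym; rewrite vst; exact: goto.
Qed.

Variables (m : nat) (ell : 'I_m -> 'I_L)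
  (Q : 'I_m -> bmonomial (graph_monomial L K) K).

Definition net_epsilon : net := net_constrain true
  (\big[@net_mul L K/net_one]_(i < m) net_constrain false (net_monomial (ell i) (Q i))).

Definition net_moment (p : nat) : net :=
  \big[@net_mul L K/net_one]_(i < p) net_mul net_epsilon (net_adj net_epsilon).

Hypothesis Qcactus : forall i (j : 'I_(bm_degree (Q i)).+1),
  cactus_type (bm_coef (Q i) j).

Lemma joins_roots_monomial i : joins_roots (net_monomial (ell i) (Q i)) (ell i).
Proof.
apply: joins_roots_mul; first by apply: joins_roots_graph; case: (@Qcactus i ord0).
apply: joins_roots_prod => j; apply: joins_roots_mul; first exact: joins_roots_var.
by apply: joins_roots_graph; case: (@Qcactus i (lift ord0 j)).
Qed.

Lemma net_connected_monomial i : net_connected (net_monomial (ell i) (Q i)).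
Proof.
apply: net_connected_mul; first exact: net_connected_graph.
apply: net_connected_prod => j; apply: net_connected_mul.
  exact: net_connected_var.
exact: net_connected_graph.
Qed.

Lemma net_even_monomial i : net_even (net_monomial (ell i) (Q i)).
Proof.
apply: net_even_mul; first exact: net_even_cactus.
apply: net_even_prod => j; apply: net_even_mul; first exact: net_even_var.
exact: net_even_cactus.
Qed.

Lemma net_connected_moment p : net_connected (net_moment p).
Proof.
have h : net_connected net_epsilon.
  apply: net_connected_constrain; apply: net_connected_prod => i.
  exact/net_connected_constrain/net_connected_monomial.
by apply: net_connected_prod => i; exact: net_connected_mul.
Qed.

Lemma net_even_moment p : net_even (net_moment p).
Proof.
have h : net_even net_epsilon.
  apply: net_even_constrain; apply: net_even_prod => i.
  exact/net_even_constrain/net_even_monomial.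
by apply: net_even_prod => i; apply: net_even_mul => //; exact: net_even_adj.
Qed.

Lemma splittable_moment p : (2 <= m)%N -> (1 <= p)%N ->
  (forall i j : 'I_m, j = i.+1 :> nat -> ell i != ell j) ->
  splittable (net_moment p).
Proof.
case: p => // p m2 _ alt; rewrite /net_moment big_ord_recl.
apply: splittable_mull; apply: splittable_mull.
apply: (main_walk_splittable m2 alt); apply: main_walk_prod => i.
exact: joins_roots_monomial.
Qed.

End Alternation.

Lemma net_eval_epsilon (R : realType) L K N (A : 'I_L -> K -> 'M[R[i]]_N) m
    (ell : 'I_m -> 'I_L) (Q : 'I_m -> bmonomial (graph_monomial L K) K) :
  net_eval A (net_epsilon ell Q) = epsilon A ell Q.
Proof.
rewrite net_eval_diag net_eval_prod; congr diag_part; apply: eq_bigr => i _.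
by rewrite net_eval_centered net_eval_monomial.
Qed.

Lemma net_eval_moment (R : realType) L K N (A : 'I_L -> K -> 'M[R[i]]_N) m
    (ell : 'I_m -> 'I_L) (Q : 'I_m -> bmonomial (graph_monomial L K) K) p :
  net_eval A (net_moment ell Q p) =
    (epsilon A ell Q *m adjoint (epsilon A ell Q)) ^+ p.
Proof.
rewrite net_eval_prod (eq_bigr (fun=> epsilon A ell Q *m adjoint (epsilon A ell Q))).
  by rewrite prodr_const card_ord.
move=> i _; rewrite net_eval_mul net_eval_epsilon; congr (_ *m _).
by apply/matrixP => j k; rewrite net_eval_adj net_eval_epsilon !mxE.
Qed.

(** * Averages over permutations *)
Section KernelSums.
Variables (C : numClosedFieldType) (N : nat).

(** A kernel on the positions is a set of equality and distinctness constraints,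
    one for each pair of positions. *)
Lemma norm_kernel_walk_sum m (Y : eqType) (x : 'I_m.+1 -> Y) (B : nat -> 'M[C]_N) c :
  0 <= c -> (forall t, (t < m)%N -> op_bounded (B t) c) ->
  `|\sum_(psi : {ffun 'I_m.+1 -> 'I_N} |
       [forall a, forall b, (psi a == psi b) == (x a == x b)])
     \prod_(t < m) B t (psi (widen_ord (leqnSn m) t)) (psi (lift ord0 t))|
  <= 2 ^+ (m.+1 * m.+1) * (c ^+ m * N%:R).
Proof.
move=> c0 Bc.
pose cs := [seq (a, b, x a == x b) | a <- enum 'I_m.+1, b <- enum 'I_m.+1].
have szcs : size cs = (m.+1 * m.+1)%N by rewrite size_allpairs -cardE card_ord.
have := norm_constrained_walk_sum (w := fun _ _ => 1) cs c0 Bc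
  (fun _ _ => eq_ind_r (fun z => z <= 1) (lexx 1) (normr1 C)).
rewrite szcs; apply: le_trans; rewrite le_eqVlt; apply/orP; left; apply/eqP.
congr (`|_|); rewrite big_mkcond; apply: eq_bigr => psi _.
rewrite /walk_weight [X in _ * (X * _)]big1 // mul1r.
case: ifPn => [/forallP all_c|].
  rewrite [X in _ = X * _]big1_seq ?mul1r // => k /andP[_] /allpairsP[[a b] [_ _ ->]] /=.
  by rewrite /constraint_holds /= (forallP (all_c a) b).
case/forallPn => a /forallPn[b ab].
have : (a, b, x a == x b) \in cs by apply: allpairs_f; rewrite mem_enum.
move=> /(big_rem _) -> /=.
by rewrite /constraint_holds /= (negPf ab) !mul0r.
Qed.

Variables (Y E : finType) (s t : E -> Y).

Definition step_matrix (M : E -> 'M[C]_N) (d : E * bool) : 'M[C]_N :=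
  if d.2 then M d.1 else (M d.1)^T.

Lemma step_matrixE M (g : Y -> 'I_N) d :
  step_matrix M d (g (dart_src s t d)) (g (dart_tgt s t d)) =
  M d.1 (g (t d.1)) (g (s d.1)).
Proof.
by rewrite /step_matrix /dart_src /dart_tgt; case: d.2; rewrite // mxE.
Qed.

Lemma prod_along_walk (M : E -> 'M[C]_N) (g : Y -> 'I_N) y0 a p b : walk s t a p b ->
  \prod_(d <- p) M d.1 (g (t d.1)) (g (s d.1)) =
  \prod_(k < size p) (nth 0 [seq step_matrix M d | d <- p] k)
    (g (nth y0 (walk_vertices s t a p) k)) (g (nth y0 (walk_vertices s t a p) k.+1)).
Proof.
elim: p a => [|d p IH] a; first by rewrite big_nil big_ord0.
case/andP=> /eqP da wp; rewrite big_cons big_ord_recl /=.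
by rewrite -step_matrixE da (IH _ wp).
Qed.

End KernelSums.

Section Averages.
Variables (L : nat) (K : Type).
Local Notation net := (net L K).

Definition permuted (C : comNzRingType) N (sigma : {ffun 'I_L -> 'S_N})
    (A : 'I_L -> K -> 'M[C]_N) (l : 'I_L) (k : K) : 'M[C]_N :=
  \matrix_(i, j) A l k (sigma l i) (sigma l j).

Variable C : numClosedFieldType.

Lemma op_bounded_net_matrix N (A : 'I_L -> K -> 'M[C]_N) (n : net) c :
  (forall l k, op_bounded (A l k) c) -> forall e, op_bounded (@net_matrix _ _ _ _ A n e) c.
Proof.
by move=> Ac e; rewrite /net_matrix; case: net_conj => //; exact: op_bounded_conj.
Qed.

Lemma op_bounded_permuted N (sigma : {ffun 'I_L -> 'S_N})
    (A : 'I_L -> K -> 'M[C]_N) c :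
  (forall l k, op_bounded (A l k) c) ->
  forall l k, op_bounded (permuted sigma A l k) c.
Proof. by move=> Ac l k; exact: op_bounded_reindex. Qed.

Lemma net_matrix_permuted N (sigma : {ffun 'I_L -> 'S_N})
    (A : 'I_L -> K -> 'M[C]_N) (n : net) (e : net_edge n) i j :
  net_matrix (permuted sigma A) e i j =
  net_matrix A e (sigma (net_family e) i) (sigma (net_family e) j).
Proof. by rewrite /net_matrix; case: net_conj; rewrite !mxE. Qed.

(** The maps phi with a given kernel, represented by an idempotent map r on the
    vertices. *)
Section OneKernel.
Variables (N : nat) (A : 'I_L -> K -> 'M[C]_N) (n : net).
Local Notation V := (net_vertex n).
Local Notation E := (net_edge n).
Variables (r : {ffun V -> V}) (x0 : V) (l : 'I_L) (c : C).
Hypothesis Ac : forall l k, op_bounded (A l k) c.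
Hypothesis c_ge0 : 0 <= c.
Hypothesis r_idem : forall u, r (r u) = r u.
Hypothesis r_link : forall u v, linked (image_src r) (image_tgt r) (r u) (r v).
Hypothesis r_even : forall x, ~~ odd (degree (image_src r) (image_tgt r) setT x).
Hypothesis x0_split : linked (split_src r x0 l) (split_tgt r x0 l) (x0, true) (x0, false).

Definition has_kernel (phi : {ffun V -> 'I_N}) : bool :=
  [forall u, forall v, (phi u == phi v) == (r u == r v)].

Lemma has_kernelP phi : has_kernel phi -> forall u v, (phi u == phi v) = (r u == r v).
Proof. by move=> /forallP h u v; exact: (eqP (forallP (h u) v)). Qed.

Lemma has_kernel_rep phi : has_kernel phi -> forall u, phi (r u) = phi u.
Proof. by move=> /has_kernelP h u; apply/eqP; rewrite h r_idem. Qed.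

Lemma split_edge b : exists e, (split_src r x0 l e == (x0, b)) || (split_tgt r x0 l e == (x0, b)).
Proof.
apply/existsP; rewrite -[X in is_true X]negbK negb_exists; apply/negP => /forallP none.
have inv e : (split_src r x0 l e == (x0, b)) = (split_tgt r x0 l e == (x0, b)).
  by have := none e; rewrite negb_or => /andP[/negPf-> /negPf->].
have := x0_split (U := fun z => z == (x0, b)) inv.
by rewrite !xpair_eqE eqxx; case: b {none inv}.
Qed.

Lemma r_x0 : r x0 = x0.
Proof.
have [e /orP[]/eqP[<- _]] := split_edge true; exact: r_idem.
Qed.

(** A path of the quotient graph lifts to the split graph because the two halves
    of x0 are linked. *)
Lemma linked_split_at u b : (u, b) = (r u, false) \/ (u, b) = (x0, true) ->
  linked (split_src r x0 l) (split_tgt r x0 l) (x0, true) (u, b).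
Proof.
have lift (U : V * bool -> bool) : (forall e, U (split_src r x0 l e) = U (split_tgt r x0 l e)) ->
    forall e, U (image_src r e, false) = U (image_tgt r e, false).
  move=> Ue; have Ux := x0_split Ue.
  have Uh c' v : U (split_at x0 l c' v) = U (v, false).
    rewrite /split_at; have [->|_] := eqVneq v x0; last by [].
    by case: (c' == l) => /=; rewrite ?Ux.
  by move=> e; have := Ue e; rewrite /split_src /split_tgt !Uh.
case=> [[ru ->]|->] // U Ue; rewrite (x0_split Ue).
rewrite ru -{1}r_x0.
exact: (r_link x0 u (U := fun v => U (v, false)) (lift U Ue)).
Qed.

(** The placement of the split graph that extends phi and puts the half
    (x0, true) at y. *)
Definition placement (phi : {ffun V -> 'I_N}) (y : 'I_N) (q : V * bool) : 'I_N :=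
  if q.2 then y else phi q.1.

Definition split_weight (B : E -> 'M[C]_N) phi y : C :=
  \prod_e B e (placement phi y (split_tgt r x0 l e)) (placement phi y (split_src r x0 l e)).

(** The two halves share the even degree of x0, hence are both even or both
    odd. *)
Lemma odd_split_degree (y : V * bool) :
  odd (degree (split_src r x0 l) (split_tgt r x0 l) setT y) =
    (y.1 == x0) && odd (degree (split_src r x0 l) (split_tgt r x0 l) setT (x0, true)).
Proof.
have degE (x : V) : degree (image_src r) (image_tgt r) setT x =
  (degree (split_src r x0 l) (split_tgt r x0 l) setT (x, true) +
   degree (split_src r x0 l) (split_tgt r x0 l) setT (x, false))%N.
  rewrite /degree -big_split; apply: eq_bigr => e _ /=.
  rewrite /incidence addnACA /split_src /split_tgt /split_at !xpair_eqE.
  by case: (image_src r e == x); case: (image_tgt r e == x);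
    case: ((image_src r e == x0) && _); case: ((image_tgt r e == x0) && _).
case: y => x b /=; have [->|xx0] /= := eqVneq x x0.
  case: b => //; have := r_even x0; rewrite degE oddD.
  by case: (odd (degree _ _ _ (x0, true))); case: (odd _).
have dT : degree (split_src r x0 l) (split_tgt r x0 l) setT (x, true) = 0%N.
  apply: big1 => e _; rewrite /incidence /split_src /split_tgt /split_at !xpair_eqE.
  have nx v : (v == x) && ((v == x0) && (net_family e == l) == true) = false.
    by have [->|//] := eqVneq v x; rewrite (negPf xx0).
  by rewrite !nx.
by case: b; rewrite ?dT //; have := r_even x; rewrite degE dT => /negPf.
Qed.

(** The split graph has an Euler trail, along which the placements (phi, y)
    become the walks whose kernel is that of the trail itself. *)
Lemma norm_split_sum (B : E -> 'M[C]_N) : (forall e, op_bounded (B e) c) ->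
  `|\sum_(q : {ffun V -> 'I_N} * 'I_N | has_kernel q.1 && (q.2 \notin codom q.1))
      split_weight B q.1 q.2|
  <= 2 ^+ (#|E|.+1 * #|E|.+1) * (c ^+ #|E| * N%:R).
Proof.
move=> Bc.
pose s := split_src r x0 l; pose t := split_tgt r x0 l; pose a0 := (x0, true).
(* The trail is closed if the halves of x0 have even degree. *)
pose b0 := if odd (degree s t setT a0) then (x0, false) else a0.
have par y : odd (degree s t setT y) = (a0 == y) (+) (b0 == y).
  rewrite odd_split_degree -/s -/t -/a0 /b0.
  case: y => x b; case: (odd _); rewrite ?andbF ?addbb // andbT.
  rewrite !xpair_eqE [x0 == x]eq_sym /=.
  by case: (x == x0); case: b.
have con e : linked s t a0 (s e).
  rewrite {2}/s /split_src /split_at /image_src /=.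
  case: (boolP ((r (net_src e) == x0) && (net_family e == l))) => [/andP[/eqP -> _]|_].
    by [].
  by apply: linked_split_at; left; rewrite r_idem.
have [p [wp up allp]] := euler_trail par con.
have sizep : size p = #|E|.
  rewrite -(size_map fst p) -(card_uniqP up); apply: eq_card => e.
  by rewrite allp inE.
pose xs := walk_vertices s t a0 p.
have in_xs y : linked s t a0 y -> y \in xs.
  move=> /(_ (fun y => y \in xs)) <-; first by rewrite mem_head.
  by move=> e; have /andP[-> ->] := mem_walk_vertices_edge wp (allp e).
have xsP y : y \in xs -> y = (r y.1, false) \/ y = (x0, true).
  rewrite inE => /orP[/eqP ->|]; first by right.
  case/mapP=> d _ ->; rewrite /dart_tgt.
  have hP v e : split_at x0 l (net_family e) (r v) =
      (r (split_at x0 l (net_family e) (r v)).1, false) \/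
      split_at x0 l (net_family e) (r v) = (x0, true).
    rewrite /split_at /= r_idem; case: (boolP (_ && _)); last by left.
    by case/andP=> /eqP -> _; right.
  by case: d.2; exact: hP.
pose m := size p.
have size_xs : size xs = m.+1 by rewrite /= size_map.
pose x (a : 'I_m.+1) := nth a0 xs a.
pose pos y : 'I_m.+1 := inord (index y xs).
have posK y : y \in xs -> x (pos y) = y.
  move=> yx; rewrite /x inordK ?nth_index //.
  by rewrite -size_xs index_mem.
have x_xs a : x a \in xs by apply: mem_nth; rewrite size_xs.
have rF u : (r u, false) \in xs by apply/in_xs/linked_split_at; left; rewrite r_idem.
have x0T : (x0, true) \in xs by apply/in_xs.
(* [h] and [h'] exchange placements of the split graph and walks. *)
pose h (q : {ffun V -> 'I_N} * 'I_N) : {ffun 'I_m.+1 -> 'I_N} :=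
  [ffun a => placement q.1 q.2 (x a)].
pose h' (psi : {ffun 'I_m.+1 -> 'I_N}) : {ffun V -> 'I_N} * 'I_N :=
  ([ffun u => psi (pos (r u, false))], psi (pos (x0, true))).
pose Bs := [seq step_matrix B d | d <- p].
rewrite -sizep -/m.
have Bsc k : (k < m)%N -> op_bounded (nth 0 Bs k) c.
  move=> km; have : nth 0 Bs k \in Bs by rewrite mem_nth ?size_map.
  case/mapP=> d _ ->; rewrite /step_matrix; case: d.2 => //.
  by apply: op_bounded_trmx => //; exact: ger0_real.
apply: le_trans (norm_kernel_walk_sum x c_ge0 Bsc).
rewrite le_eqVlt; apply/orP; left; apply/eqP; congr (`|_|).
rewrite [RHS](reindex_onto h h') => [|psi /forallP ker]; last first.
  apply/ffunP => a; rewrite !ffunE /placement /=.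
  have kerE b b' : x b = x b' -> psi b = psi b'.
    by move=> bb'; apply/eqP; rewrite (eqP (forallP (ker b) b')) bb'.
  have [xa|xa] := xsP _ (x_xs a).
    rewrite xa /= ffunE; apply: kerE; rewrite r_idem posK //.
  by rewrite xa /=; apply: kerE; rewrite posK.
apply: eq_big => [[phi y]|[phi y] _] /=; last first.
  have -> : split_weight B phi y =
      \prod_(e <- enum E) B e (placement phi y (t e)) (placement phi y (s e)).
    by rewrite big_enum.
  have -> : \prod_(e <- enum E) B e (placement phi y (t e)) (placement phi y (s e))
     = \prod_(d <- p) B d.1 (placement phi y (t d.1)) (placement phi y (s d.1)).
    have pe : perm_eq (enum E) [seq d.1 | d <- p].
      by apply: uniq_perm => //; [exact: enum_uniq|move=> e; rewrite mem_enum allp].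
    by rewrite (perm_big _ pe) big_map.
  rewrite (prod_along_walk _ _ a0 wp); apply: eq_bigr => k _.
  by rewrite !ffunE.
apply/andP/andP => [[phiK yphi]|[/forallP ker /eqP[phiE yE]]].
  have phiE := has_kernelP phiK.
  have yne u : (y == phi u) = false.
    by apply/negP => /eqP yu; rewrite yu codom_f in yphi.
  split.
    apply/forallP => a; apply/forallP => b; apply/eqP; rewrite !ffunE /placement.
    have [->|->] := xsP _ (x_xs a); have [->|->] := xsP _ (x_xs b) => /=.
    - by rewrite phiE !r_idem xpair_eqE andbT.
    - by rewrite eq_sym yne xpair_eqE andbF.
    - by rewrite yne xpair_eqE andbF.
    - by rewrite !eqxx.
  apply/eqP; congr (_, _); last by rewrite ffunE posK.
  by apply/ffunP => u; rewrite !ffunE posK // /placement /= has_kernel_rep.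
have {}phiE u : phi u = h (phi, y) (pos (r u, false)) by rewrite -{1}phiE ffunE.
split.
  apply/forallP => u; apply/forallP => v; rewrite !phiE.
  by rewrite (eqP (forallP (ker _) _)) !posK // xpair_eqE andbT.
apply/negP => /codomP[u yu].
have : h (phi, y) (pos (x0, true)) == h (phi, y) (pos (r u, false)).
  by rewrite -phiE -yu -{2}yE.
by rewrite (eqP (forallP (ker _) _)) !posK // xpair_eqE andbF.
Qed.

(** Composing the permutation of colour l with the transposition of phi(x0) and
    y moves the edges of colour l at phi(x0) to y, and affects no other edge as
    y is not in the range of phi. *)
Lemma sum_over_fresh phi y : has_kernel phi -> y \notin codom phi ->
  \sum_(sigma : {ffun 'I_L -> 'S_N}) net_weight (permuted sigma A) phi =
  \sum_(sigma : {ffun 'I_L -> 'S_N})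
    split_weight (fun e => net_matrix (permuted sigma A) e) phi y.
Proof.
move=> phiK yphi; pose tau := tperm (phi x0) y.
pose h (sigma : {ffun 'I_L -> 'S_N}) :=
  [ffun k => if k == l then (tau * sigma k)%g else sigma k].
have hK : involutive h.
  move=> sigma; apply/ffunP => k; rewrite !ffunE; case: eqP => // _.
  by rewrite mulgA tperm2 mul1g.
rewrite (reindex_inj (inv_inj hK)) /=; apply: eq_bigr => sigma _.
apply: eq_bigr => e _; rewrite !net_matrix_permuted !ffunE.
have key v : (if net_family e == l then (tau * sigma (net_family e))%g
      else sigma (net_family e)) (phi v) =
    sigma (net_family e) (placement phi y (split_at x0 l (net_family e) (r v))).
  rewrite /placement /split_at /=; case: eqP => _; rewrite ?andbF ?andbT /=; last first.
    by rewrite has_kernel_rep.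
  rewrite permM; congr (sigma _ _); have [rv|rv] := eqVneq (r v) x0.
    have -> : phi v = phi x0 by rewrite -(has_kernel_rep phiK v) rv.
    by rewrite tpermL.
  rewrite tpermD ?has_kernel_rep //.
    by rewrite (has_kernelP phiK) r_x0 eq_sym.
  by apply/eqP => yv; rewrite yv codom_f in yphi.
by rewrite !key.
Qed.

Lemma card_codom_kernel phi : has_kernel phi -> #|codom phi| = #|codom r|.
Proof.
move=> phiK.
rewrite -[RHS](@card_in_image _ _ phi) => [|u v]; last first.
  case/codomP=> u' -> /codomP[v' ->] /eqP; rewrite (has_kernelP phiK) !r_idem.
  by move/eqP.
apply: eq_card => i; apply/codomP/imageP => [[u ->]|[u _ ->]]; last by exists u.
by exists (r u); rewrite ?codom_f // has_kernel_rep.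
Qed.

(** Averaging [sum_over_fresh] over the N - k fresh values y gives the sum over
    placements of the split graph, of order N, divided by N - k. *)
Lemma norm_kernel_sum : (2 * #|V| <= N)%N ->
  `|\sum_(sigma : {ffun 'I_L -> 'S_N}) \sum_(phi | has_kernel phi)
      net_weight (permuted sigma A) phi|
  <= #|{ffun 'I_L -> 'S_N}|%:R *
       (2 * (2 ^+ (#|E|.+1 * #|E|.+1) * c ^+ #|E|)).
Proof.
move=> N2V; set D := 2 ^+ _ * c ^+ _; set S := leLHS.
have N0 : (0 < N)%N.
  apply: leq_trans N2V; rewrite muln_gt0 /=; apply/card_gt0P; by exists x0.
pose k := #|codom r|.
have kN : (2 * k <= N)%N.
  by apply: leq_trans N2V; rewrite leq_mul2l /= max_card.
have key : (N - k)%:R * (\sum_(sigma : {ffun 'I_L -> 'S_N}) \sum_(phi | has_kernel phi)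
      net_weight (permuted sigma A) phi) =
    \sum_(sigma : {ffun 'I_L -> 'S_N})
    \sum_(q : {ffun V -> 'I_N} * 'I_N | has_kernel q.1 && (q.2 \notin codom q.1))
      split_weight (fun e => net_matrix (permuted sigma A) e) q.1 q.2.
  rewrite exchange_big /= big_distrr /= [RHS]exchange_big /=.
  rewrite -(pair_big_dep has_kernel (fun phi y => y \notin codom phi)
    (fun phi y => \sum_(sigma : {ffun 'I_L -> 'S_N})
      split_weight (fun e => net_matrix (permuted sigma A) e) phi y)) /=.
  apply: eq_bigr => phi phiK.
  rewrite [RHS](eq_bigr (fun=> \sum_(sigma : {ffun 'I_L -> 'S_N})
    net_weight (permuted sigma A) phi)) => [|y yphi]; last first.
    by rewrite (sum_over_fresh phiK yphi).
  rewrite sumr_const -[RHS]mulr_natl; congr (_%:R * _).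
  rewrite /k -(card_codom_kernel phiK).
  have := congr1 (subn^~ #|codom phi|) (cardC (mem (codom phi))).
  by rewrite addKn card_ord /= => <-; apply: eq_card => y; rewrite !inE.
have Nk : (N <= 2 * (N - k))%N by rewrite mulnBr mul2n -addnn -addnBA // leq_addr.
have N0' : 0 < N%:R :> C by rewrite ltr0n.
rewrite -(ler_pM2l N0').
apply: (@le_trans _ _ (2 * ((N - k)%:R * S))).
  by rewrite mulrA -natrM ler_wpM2r ?normr_ge0 // ler_nat.
rewrite /S -{1}[(N - k)%:R]ger0_norm // -normrM key.
rewrite mulrCA [N%:R * _]mulrCA [leRHS]mulrCA; apply: ler_wpM2l => //.
apply: le_trans (ler_norm_sum _ _ _) _.
rewrite -sumr_const mulr_suml; apply: ler_sum => sigma _; rewrite mul1r.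
rewrite mulrC -mulrA; apply: norm_split_sum => e.
by apply: op_bounded_net_matrix; exact: op_bounded_permuted.
Qed.

End OneKernel.

(** The number of kernels does not depend on N, so it is enough to bound the sum
    over the maps of a given kernel; if this kernel respects the constraints, it
    is a quotient to which the hypotheses on the net apply. *)
Theorem norm_average_trace (n : net) (c : C) : 0 <= c ->
  net_connected n -> net_even n -> splittable n ->
  exists2 M : C, 0 <= M & forall N (A : 'I_L -> K -> 'M[C]_N),
    (2 * #|net_vertex n| <= N)%N -> (forall l k, op_bounded (A l k) c) ->
    `|\sum_(sigma : {ffun 'I_L -> 'S_N}) \tr (net_eval (permuted sigma A) n)|
      <= #|{ffun 'I_L -> 'S_N}|%:R * M.
Proof.
move=> c0 con ev sp.
set V := net_vertex n; set E := net_edge n.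
pose M1 : C := 2 * (2 ^+ (#|E|.+1 * #|E|.+1) * c ^+ #|E|).
have M10 : 0 <= M1 by rewrite !mulr_ge0 ?exprn_ge0.
exists (#|{ffun V -> V}|%:R * M1); first by rewrite mulr_ge0.
move=> N A NV Ac.
under eq_bigr do rewrite trace_net_eval.
(* The choice depends on the set of vertices with the same image only, so that
   [ker phi] determines the kernel of phi. *)
pose ker (phi : {ffun V -> 'I_N}) : {ffun V -> V} :=
  [ffun u => odflt u [pick v | phi v == phi u]].
have kerP (phi : {ffun V -> 'I_N}) u : phi (ker phi u) = phi u.
  by rewrite ffunE; case: pickP => [v /eqP //|/(_ u)]; rewrite eqxx.
have kerE (phi : {ffun V -> 'I_N}) u v : (ker phi u == ker phi v) = (phi u == phi v).
  apply/eqP/eqP => [h|h]; first by rewrite -kerP h kerP.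
  have pickE : [pick w | phi w == phi u] = [pick w | phi w == phi v].
    by apply: eq_pick => w; rewrite h.
  by rewrite !ffunE pickE; case: pickP => // /(_ v); rewrite eqxx.
under eq_bigr do rewrite (partition_big ker xpredT) //=.
rewrite exchange_big /=; apply: le_trans (ler_norm_sum _ _ _) _.
rewrite mulrCA -sumr_const mulr_suml; apply: ler_sum => r _; rewrite mul1r.
case: (pickP (fun phi : {ffun V -> 'I_N} =>
  @compatible _ _ (net_constrain true n) _ phi && (ker phi == r))); last first.
  move=> none; rewrite big1 ?normr0 ?mulr_ge0 ?exprn_ge0 // => sigma _.
  by rewrite big_pred0.
move=> phi0 /andP[comp0 /eqP phi0r].
have r_idem u : r (r u) = r u by apply/eqP; rewrite -phi0r kerE kerP.
have comp_ker (phi : {ffun V -> 'I_N}) : (forall u v, (phi u == phi v) = (r u == r v)) ->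
    @compatible _ _ (net_constrain true n) _ phi =
    @compatible _ _ (net_constrain true n) _ r.
  by move=> h; rewrite /compatible; apply: eq_all => k; rewrite h.
have comp_r : @compatible _ _ (net_constrain true n) _ r.
  by rewrite -(comp_ker phi0) // => u v; rewrite -phi0r kerE.
have /andP[/= inout comp_n] := comp_r; rewrite eqb_id in inout.
have [x0 [l x0_split]] := sp _ _ comp_n.
have r_even x : ~~ odd (degree (image_src r) (image_tgt r) setT x).
  by rewrite (ev _ _ comp_n) (eqP inout) addbb.
have := norm_kernel_sum Ac c0 r_idem (con _ _ comp_n) r_even x0_split NV.
apply: le_trans; rewrite le_eqVlt; apply/orP; left; apply/eqP; congr (`|_|).
apply: eq_bigr => sigma _; apply: eq_bigl => phi.
apply/andP/idP => [[_ /eqP phir]|phiK].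
  by apply/forallP => u; apply/forallP => v; rewrite -phir kerE.
have h := has_kernelP phiK; split; first by rewrite (comp_ker phi).
apply/eqP/ffunP => u; rewrite -phi0r !ffunE.
have -> : [pick v | phi v == phi u] = [pick v | phi0 v == phi0 u]; last by [].
by apply: eq_pick => v; rewrite h -phi0r kerE.
Qed.

End Averages.

Import numFieldNormedType.Exports.

Local Open Scope classical_set_scope.
Local Open Scope ring_scope.

(** * Operator norm and positivity *)
Section OperatorNorm.
Variable R : realType.
Local Open Scope complex_scope.

Let CM (x y : R) : (x * y)%:C = x%:C * y%:C.
Proof. exact: (rmorphM (real_complex R)). Qed.

Let CX (x : R) k : (x ^+ k)%:C = x%:C ^+ k.
Proof. exact: (rmorphXn (real_complex R)). Qed.

Let Csum (I : finType) (F : I -> R) : (\sum_i F i)%:C = \sum_i (F i)%:C.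
Proof. exact: (rmorph_sum (real_complex R)). Qed.

Lemma l2norm_ge0 n (v : 'cV[R[i]]_n) : 0 <= l2norm v.
Proof. exact: sqrtr_ge0. Qed.

Lemma sqnorm_l2norm n (v : 'cV[R[i]]_n) : sqnorm v = (l2norm v ^+ 2)%:C.
Proof.
rewrite sqr_sqrtr; last first.
  by apply: sumr_ge0 => i _; rewrite addr_ge0 // sqr_ge0.
by rewrite Csum; apply: eq_bigr => i _; rewrite add_Re2_Im2.
Qed.

Lemma l2normZ n (a : R) (v : 'cV[R[i]]_n) : 0 <= a ->
  l2norm (a%:C *: v) = a * l2norm v.
Proof.
move=> a0; apply/eqP; rewrite -(@eqrXn2 _ 2) ?mulr_ge0 ?l2norm_ge0 //.
suff /complexI-> : (l2norm (a%:C *: v) ^+ 2)%:C = ((a * l2norm v) ^+ 2)%:C by [].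
rewrite exprMn [RHS]CM -!sqnorm_l2norm /sqnorm mulr_sumr.
apply: eq_bigr => i _; rewrite mxE normrM exprMn; congr (_ * _).
by rewrite ger0_norm ?ler0c // CX.
Qed.

(** The Frobenius norm; it shows that the supremum defining the operator norm is
    that of a bounded set. *)
Lemma l2norm_mulmx_bound n (A : 'M[R[i]]_n) :
  exists F : R, forall v, l2norm (A *m v) <= F * l2norm v.
Proof.
pose G := \sum_i l2norm (row i A)^T ^+ 2.
exists (Num.sqrt G) => v.
have G0 : 0 <= G by apply: sumr_ge0 => i _; rewrite sqr_ge0.
rewrite -(@ler_pXn2r _ 2) ?nnegrE ?mulr_ge0 ?l2norm_ge0 ?sqrtr_ge0 //.
rewrite exprMn (sqr_sqrtr G0) -lecR [leRHS]CM -!sqnorm_l2norm Csum mulr_suml.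
apply: ler_sum => i _; rewrite -sqnorm_l2norm mxE.
apply: le_trans (cauchy_schwarz _ _) _; rewrite ler_wpM2r ?sqnorm_ge0 //.
by apply: ler_sum => j _; rewrite !mxE.
Qed.

Lemma opnorm_has_ubound n (A : 'M[R[i]]_n) :
  has_ubound [set l2norm (A *m v) | v in [set v : 'cV[R[i]]_n | l2norm v <= 1]].
Proof.
have [F FP] := l2norm_mulmx_bound A.
exists `|F| => _ [u u1 <-]; apply: le_trans (FP u) _.
apply: (@le_trans _ _ (`|F| * l2norm u)).
  by rewrite ler_wpM2r ?l2norm_ge0 // ler_norm.
by rewrite ler_piMr.
Qed.

Lemma l2norm_mulmx n (A : 'M[R[i]]_n) v : l2norm (A *m v) <= opnorm A * l2norm v.
Proof.
have [v0|v0] := eqVneq (l2norm v) 0.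
  by have [F FP] := l2norm_mulmx_bound A; have := FP v; rewrite v0 !mulr0.
have vpos : 0 < l2norm v by rewrite lt_def v0 l2norm_ge0.
have : l2norm (A *m ((l2norm v)^-1%:C *: v)) <= opnorm A.
  apply: ub_le_sup (opnorm_has_ubound A) _ _; exists ((l2norm v)^-1%:C *: v) => //=.
  by rewrite l2normZ ?invr_ge0 ?l2norm_ge0 // mulVf.
by rewrite -scalemxAr l2normZ ?invr_ge0 ?l2norm_ge0 // ler_pdivrMl // mulrC.
Qed.

Lemma opnorm_ge0 n (A : 'M[R[i]]_n) : 0 <= opnorm A.
Proof.
have l0 : l2norm (0 : 'cV[R[i]]_n) = 0.
  suff /complexI/eqP : (l2norm (0 : 'cV[R[i]]_n) ^+ 2)%:C = 0%:C.
    by rewrite sqrf_eq0 => /eqP.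
  by rewrite -sqnorm_l2norm /sqnorm big1 // => i _; rewrite mxE normr0 expr0n.
by apply: ub_le_sup (opnorm_has_ubound A) _ _; exists 0; rewrite /= ?mulmx0 l0.
Qed.

Lemma opnorm_op_bounded n (A : 'M[R[i]]_n) (c : R) : opnorm A <= c ->
  op_bounded A c%:C.
Proof.
move=> Ac v; rewrite !sqnorm_l2norm -CX -CM lecR -exprMn.
have c0 : 0 <= c := le_trans (opnorm_ge0 A) Ac.
rewrite lerXn2r ?nnegrE ?mulr_ge0 ?l2norm_ge0 //.
by apply: le_trans (l2norm_mulmx A v) _; rewrite ler_wpM2r ?l2norm_ge0.
Qed.

End OperatorNorm.

Section PositiveMoments.
Variable R : realType.

(** The moments of a diagonal matrix are nonnegative because nonnegative
    diagonal matrices are stable under products. *)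
Definition nonneg_diag n (B : 'M[R[i]]_n) : Prop :=
  forall i j, (B i j = B i i *+ (i == j)) /\ 0 <= B i i.

Lemma nonneg_diag_mul n (B1 B2 : 'M[R[i]]_n) :
  nonneg_diag B1 -> nonneg_diag B2 -> nonneg_diag (B1 *m B2).
Proof.
move=> h1 h2.
have E i j : (B1 *m B2) i j = (B1 i i * B2 i i) *+ (i == j).
  rewrite mxE (bigD1 i) //= big1 ?addr0 => [|k ki]; last first.
    by have [-> _] := h1 i k; rewrite eq_sym (negPf ki) mul0r.
  by have [-> _] := h2 i j; rewrite mulrnAr.
move=> i j; rewrite !E eqxx; split=> //.
by rewrite mulr_ge0 //; [have [] := h1 i i|have [] := h2 i i].
Qed.

Lemma trace_moment_ge0 n (B : 'M[R[i]]_n) p :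
  0 <= \tr ((diag_part B *m adjoint (diag_part B)) ^+ p).
Proof.
set D := diag_part B.
have DD : nonneg_diag (D *m adjoint D).
  have E i j : (D *m adjoint D) i j = (B i i * (B i i)^*) *+ (i == j).
    rewrite mxE (bigD1 i) //= big1 ?addr0 => [|k ki]; last first.
      by rewrite !mxE eq_sym (negPf ki) mul0r.
    rewrite !mxE eqxx mulr1n [j == i]eq_sym.
    by have [->|_] := eqVneq i j; rewrite ?conjC0 ?mulr0.
  by move=> i j; rewrite !E eqxx; split=> //; exact: mul_conjC_ge0.
have : nonneg_diag ((D *m adjoint D) ^+ p).
  elim: p => [|p IH].
    by move=> i j; rewrite !mxE eqxx; split=> //; exact: ler01.
  by rewrite exprS; exact: nonneg_diag_mul.
by move=> h; apply: sumr_ge0 => i _; have [] := h i i.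
Qed.

End PositiveMoments.

(** * Laws of random families *)

(** A name of its own carries the base point that a measurable space requires. *)
Definition matrix_family (R : realType) (K : Type) (N : nat) : Type :=
  K -> 'M[R[i]]_N.
HB.instance Definition _ (R : realType) (K : Type) (N : nat) :=
  gen_eqMixin (matrix_family R K N).
HB.instance Definition _ (R : realType) (K : Type) (N : nat) :=
  gen_choiceMixin (matrix_family R K N).
HB.instance Definition _ (R : realType) (K : Type) (N : nat) :=
  isPointed.Build (matrix_family R K N) (fun _ => 0).

Definition entry_cylinders (R : realType) (K : Type) (N : nat) :
    set (set (matrix_family R K N)) :=
  [set B : set (K -> 'M[R[i]]_N) |
    exists (k : K) (i j : 'I_N) (U : set R), measurable U /\
      (B = [set a : K -> 'M[R[i]]_N | U (complex.Re (a k i j))] \/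
       B = [set a : K -> 'M[R[i]]_N | U (complex.Im (a k i j))])].

Definition family_space (R : realType) (K : Type) (N : nat) :=
  g_sigma_algebraType (@entry_cylinders R K N).

Definition families (R : realType) (L : nat) (K : Type) (N : nat) : Type :=
  'I_L -> K -> 'M[R[i]]_N.
HB.instance Definition _ (R : realType) (L : nat) (K : Type) (N : nat) :=
  gen_eqMixin (families R L K N).
HB.instance Definition _ (R : realType) (L : nat) (K : Type) (N : nat) :=
  gen_choiceMixin (families R L K N).
HB.instance Definition _ (R : realType) (L : nat) (K : Type) (N : nat) :=
  isPointed.Build (families R L K N) (fun _ _ => 0).

(** Independence and invariance determine the probabilities of rectangles, which
    form a pi-system. *)
Definition rectangles (R : realType) (L : nat) (K : Type) (N : nat) :
    set (set (families R L K N)) :=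
  [set B | exists2 Bl : 'I_L -> set (family_space R K N),
    (forall l, measurable (Bl l)) & B = [set a | forall l, Bl l (a l)]].

Definition families_space (R : realType) (L : nat) (K : Type) (N : nat) :=
  g_sigma_algebraType (@rectangles R L K N).

Section Families.
Variables (R : realType) (L : nat) (K : Type) (N : nat).

Lemma rectangles_setI : setI_closed (@rectangles R L K N).
Proof.
move=> _ _ [B1 m1 ->] [B2 m2 ->]; exists (fun l => B1 l `&` B2 l).
  by move=> l; exact: measurableI.
apply/seteqP; split=> a /=; first by move=> [a1 a2] l; split.
by move=> h; split=> l; have [] := h l.
Qed.

Lemma rectangles_setT : @rectangles R L K N [set: _].
Proof.
exists (fun=> [set: _]); first by move=> l; exact: measurableT.
by apply/seteqP; split.
Qed.

Lemma cmeasurable_entry (l : 'I_L) k i j : forall U : set R, measurable U ->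
  measurable [set a : families_space R L K N | U (complex.Re (a l k i j))] /\
  measurable [set a : families_space R L K N | U (complex.Im (a l k i j))].
Proof.
have rect (C : set (family_space R K N)) : entry_cylinders C ->
    measurable [set a : families_space R L K N | C (a l)].
  move=> hC; apply: sub_sigma_algebra.
  exists (fun l' => if l' == l then C else [set: _]).
    move=> l'; case: eqP => _; last exact: measurableT.
    exact: sub_sigma_algebra.
  apply/seteqP; split=> a /=; first by move=> Ca l'; case: eqP => // ->.
  by move=> /(_ l); rewrite eqxx.
move=> U mU; split.
  apply: (rect [set b | U (complex.Re (b k i j))]).
  by exists k, i, j, U; split=> //; left.
apply: (rect [set b | U (complex.Im (b k i j))]).
by exists k, i, j, U; split=> //; right.
Qed.

Section Random.
Context d (T : measurableType d).

Lemma measurable_family (X : K -> T -> 'M[R[i]]_N) :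
  (forall k, random_matrix (X k)) ->
  measurable_fun [set: _] (fun w => X ^~ w : family_space R K N).
Proof.
move=> mX; refine (@measurability d _ T (family_space R K N) _
  (fun w => X ^~ w) (@entry_cylinders R K N) _ _) => //.
move=> _ [_ [k [i [j [U [mU [->|->]]]]] <-]]; rewrite classical_sets.setTI.
  by have [h _] := mX k i j; rewrite -[X in measurable X]classical_sets.setTI; exact: h.
by have [_ h] := mX k i j; rewrite -[X in measurable X]classical_sets.setTI; exact: h.
Qed.

Lemma measurable_families (X : 'I_L -> K -> T -> 'M[R[i]]_N) :
  (forall l k, random_matrix (X l k)) ->
  measurable_fun [set: _] (fun w => (fun l k => X l k w) : families_space R L K N).
Proof.
move=> mX; refine (@measurability d _ T (families_space R L K N) _
  (fun w l k => X l k w) (@rectangles R L K N) _ _) => //.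
move=> _ [_ [B mB ->] <-]; rewrite classical_sets.setTI.
rewrite (_ : _ @^-1` _ = \bigcap_(l in [set: 'I_L]) [set w | B l (X l ^~ w)]).
  apply: fin_bigcap_measurable => // l _.
  have := measurable_family (mX l) measurableT (mB l).
  by rewrite classical_sets.setTI.
by apply/seteqP; split=> w /= h l; [move=> _; exact: h|exact: h].
Qed.

End Random.
End Families.

Section EqualLaws.
Context d d' (T : measurableType d) (T' : measurableType d') (R : realType).
Variables (P : probability T R) (X Y : T -> T').
Hypotheses (mX : measurable_fun [set: _] X) (mY : measurable_fun [set: _] Y).
Variable G : set (set T').
Hypotheses (mG : @measurable _ T' = <<s G >>) (GI : setI_closed G) (GT : G [set: _]).
Hypothesis XY : forall B, G B -> P (X @^-1` B) = P (Y @^-1` B).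

(** Nonnegativity avoids any integrability condition: the moments are bounded on
    the almost sure event of the norm bound only. *)
Lemma ge0_integral_equal_law (f : T' -> \bar R) :
  measurable_fun [set: _] f -> (forall y, (0 <= f y)%E) ->
  (\int[P]_w f (X w) = \int[P]_w f (Y w))%E.
Proof.
move=> mf f0.
pose X' : {mfun T >-> T'} := HB.pack X (isMeasurableFun.Build _ _ _ _ _ mX).
pose Y' : {mfun T >-> T'} := HB.pack Y (isMeasurableFun.Build _ _ _ _ _ mY).
have <- := @ge0_integral_distribution _ _ _ _ _ P X' f mf f0.
have <- := @ge0_integral_distribution _ _ _ _ _ P Y' f mf f0.
apply: eq_measure_integral => B mB _.
apply: (measure_unique G (fun=> [set: _])) => //.
  by rewrite bigcup_const //; exists 0%N.
by move=> _; apply: (@le_lt_trans _ _ 1%E); [exact: probability_le1|rewrite ltry].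
Qed.

End EqualLaws.

Section ComplexMeasurability.
Context d (T : measurableType d) (R : realType).

Definition cmeasurable (g : T -> R[i]) : Prop :=
  measurable_fun [set: _] (fun w => complex.Re (g w)) /\
  measurable_fun [set: _] (fun w => complex.Im (g w)).

Lemma cmeasurable_cst c : cmeasurable (fun=> c).
Proof. by split; exact: measurable_cst. Qed.

Lemma cmeasurableD g h : cmeasurable g -> cmeasurable h ->
  cmeasurable (fun w => g w + h w).
Proof.
move=> [g1 g2] [h1 h2]; split.
  rewrite (_ : (fun _ => _) = (fun w => complex.Re (g w) + complex.Re (h w))).
    exact: measurable_funD.
  by apply/funext => w; case: (g w) (h w) => [a b] [? ?].
rewrite (_ : (fun _ => _) = (fun w => complex.Im (g w) + complex.Im (h w))).
  exact: measurable_funD.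
by apply/funext => w; case: (g w) (h w) => [a b] [? ?].
Qed.

Lemma cmeasurableM g h : cmeasurable g -> cmeasurable h ->
  cmeasurable (fun w => g w * h w).
Proof.
move=> [g1 g2] [h1 h2]; split.
  rewrite (_ : (fun _ => _) = (fun w => complex.Re (g w) * complex.Re (h w)
     - complex.Im (g w) * complex.Im (h w))).
    by apply: measurable_funB; exact: measurable_funM.
  by apply/funext => w; case: (g w) (h w) => [a b] [? ?].
rewrite (_ : (fun _ => _) = (fun w => complex.Re (g w) * complex.Im (h w)
     + complex.Im (g w) * complex.Re (h w))).
  by apply: measurable_funD; exact: measurable_funM.
by apply/funext => w; case: (g w) (h w) => [a b] [? ?].
Qed.

Lemma cmeasurable_conj g : cmeasurable g -> cmeasurable (fun w => (g w)^*).
Proof.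
move=> [g1 g2]; split.
  rewrite (_ : (fun _ => _) = (fun w => complex.Re (g w))) //.
  by apply/funext => w; case: (g w).
rewrite (_ : (fun _ => _) = (fun w => - complex.Im (g w))).
  exact: measurableT_comp.
by apply/funext => w; case: (g w).
Qed.

Lemma cmeasurable_sum (I : Type) (s : seq I) (p : pred I) (g : I -> T -> R[i]) :
  (forall k, cmeasurable (g k)) -> cmeasurable (fun w => \sum_(k <- s | p k) g k w).
Proof.
move=> mg; elim: s => [|k s IH].
  by under eq_fun do rewrite big_nil; exact: cmeasurable_cst.
under eq_fun do rewrite big_cons.
by case: (p k) => //; exact: cmeasurableD.
Qed.

Lemma cmeasurable_prod (I : Type) (s : seq I) (g : I -> T -> R[i]) :
  (forall k, cmeasurable (g k)) -> cmeasurable (fun w => \prod_(k <- s) g k w).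
Proof.
move=> mg; elim: s => [|k s IH].
  by under eq_fun do rewrite big_nil; exact: cmeasurable_cst.
by under eq_fun do rewrite big_cons; exact: cmeasurableM.
Qed.

Lemma cmeasurable_trace_net L K N (n : net L K) (A : T -> 'I_L -> K -> 'M[R[i]]_N) :
  (forall l k i j, cmeasurable (fun w => A w l k i j)) ->
  cmeasurable (fun w => \tr (net_eval (A w) n)).
Proof.
move=> mA; under eq_fun do rewrite trace_net_eval.
apply: cmeasurable_sum => phi; apply: cmeasurable_prod => e.
rewrite /net_matrix; case: net_conj; last exact: mA.
by under eq_fun do rewrite mxE; apply: cmeasurable_conj; exact: mA.
Qed.

End ComplexMeasurability.

(** * Permuted families and the theorem *)
Section PermutedLaw.
Variables (R : realType) (L : nat) (K : Type) (N : nat).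

Lemma conj_perm_mx (s : 'S_N) (A : 'M[R[i]]_N) :
  perm_mx s *m A *m invmx (perm_mx s) = \matrix_(i, j) A (s i) (s j).
Proof.
have -> : invmx (perm_mx s) = perm_mx s^-1 :> 'M[R[i]]_N.
  have VS : perm_mx s^-1 *m perm_mx s = 1%:M :> 'M[R[i]]_N.
    by rewrite -perm_mxM mulVg perm_mx1.
  by rewrite -[LHS]mul1mx -VS mulmxK // unitmx_perm.
by rewrite -row_permE -col_permE; apply/matrixP => i j; rewrite !mxE.
Qed.

Lemma family_measurable_perm (s : 'S_N) (B : set (K -> 'M[R[i]]_N)) :
  family_measurable B ->
  family_measurable [set a | B (fun k => \matrix_(i, j) a k (s i) (s j))].
Proof.
move=> mB.
pose h (a : family_space R K N) : family_space R K N :=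
  fun k => \matrix_(i, j) a k (s i) (s j).
have mh : measurable_fun [set: family_space R K N] h.
  refine (@measurability _ _ (family_space R K N) (family_space R K N) _ h
    (@entry_cylinders R K N) _ _) => //.
  move=> _ [_ [k [i [j [U [mU [->|->]]]]] <-]]; rewrite classical_sets.setTI;
    apply: sub_sigma_algebra; exists k, (s i), (s j), U; split=> //; [left|right];
    by apply/seteqP; split=> a; rewrite /h /= mxE.
by have := mh measurableT B mB; rewrite classical_sets.setTI.
Qed.

Context d (T : measurableType d) (P : probability T R).
Variable A : 'I_L -> K -> T -> 'M[R[i]]_N.
Hypothesis Aind : independent_families P A.

Lemma rectangle_permuted (sigma : {ffun 'I_L -> 'S_N}) B :
  (forall l, sigma l = 1%g \/ permutation_invariant P (A l)) ->
  @rectangles R L K N B ->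
  P [set w | B (fun l k => A l k w)] =
  P [set w | B (permuted sigma (fun l k => A l k w))].
Proof.
move=> sinv [Bl mBl ->].
pose Bl' l : set (K -> 'M[R[i]]_N) :=
  [set a | Bl l (fun k => \matrix_(i, j) a k (sigma l i) (sigma l j))].
have mBl' l : family_measurable (Bl' l).
  exact: (family_measurable_perm (sigma l) (mBl l)).
have e1 := @Aind [set: 'I_L]%SET Bl (fun l _ => mBl l).
have e2 := @Aind [set: 'I_L]%SET Bl' (fun l _ => mBl' l).
transitivity (P [set w | forall l, l \in [set: 'I_L]%SET -> Bl l (A l ^~ w)]).
  congr (P _); apply/seteqP; split=> w /= h l => [_|]; first exact: h.
  by apply: h; rewrite inE.
rewrite e1; transitivity (P [set w | forall l, l \in [set: 'I_L]%SET -> Bl' l (A l ^~ w)]).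
  rewrite e2; apply: eq_bigr => l _; rewrite /Bl'.
  have [s1|inv] := sinv l.
    congr (P _); apply/funext => w /=; congr (Bl l _).
    by apply/funext => k; apply/matrixP => i j; rewrite s1 mxE !perm1.
  have Sperm : is_perm_mx (perm_mx (sigma l) : 'M[R[i]]_N).
    by apply/is_perm_mxP; exists (sigma l).
  rewrite (inv _ Sperm (Bl l) (mBl l)); congr (P _); apply/funext => w /=.
  by congr (Bl l _); apply/funext => k; rewrite conj_perm_mx.
congr (P _); apply/seteqP; split=> w /= h l => [|_]; last exact: h.
by apply: h; rewrite inE.
Qed.

End PermutedLaw.

Section GlobalConjugation.
Variables (C : numClosedFieldType) (L : nat) (K : Type) (N : nat).

Lemma trace_net_permuted_mul (n : net L K) (A : 'I_L -> K -> 'M[C]_N)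
    (sigma : {ffun 'I_L -> 'S_N}) (g : 'S_N) :
  \tr (net_eval (permuted [ffun l => (g * sigma l)%g] A) n) =
  \tr (net_eval (permuted sigma A) n).
Proof.
rewrite !trace_net_eval.
pose h (b : 'S_N) (phi : {ffun net_vertex n -> 'I_N}) : {ffun net_vertex n -> 'I_N} :=
  [ffun u => b (phi u)].
have hK : cancel (h g) (h g^-1%g) by move=> phi; apply/ffunP => u; rewrite !ffunE permK.
rewrite [RHS](reindex_inj (can_inj hK)) /=; apply: eq_big => [phi|phi _].
  rewrite /compatible; apply: eq_all => c.
  by rewrite !ffunE (inj_eq perm_inj).
by apply: eq_bigr => e _; rewrite !net_matrix_permuted !ffunE !permM.
Qed.

End GlobalConjugation.

Section MomentBound.
Variables (R : realType) (L : nat) (K : Type) (m : nat) (ell : 'I_m -> 'I_L)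
  (Q : 'I_m -> bmonomial (graph_monomial L K) K) (p : nat).

Definition moment N (a : 'I_L -> K -> 'M[R[i]]_N) : R :=
  complex.Re (N%:R^-1 * \tr (net_eval a (net_moment ell Q p))).

Lemma moment_ge0 N (a : 'I_L -> K -> 'M[R[i]]_N) : 0 <= moment a.
Proof.
rewrite /moment net_eval_moment.
have : 0 <= N%:R^-1 * \tr ((epsilon a ell Q *m adjoint (epsilon a ell Q)) ^+ p).
  by rewrite mulr_ge0 ?invr_ge0 ?ler0n // trace_moment_ge0.
by rewrite lecE => /andP[].
Qed.

Lemma cmeasurable_moment d (T : measurableType d) N (A : T -> 'I_L -> K -> 'M[R[i]]_N) :
  (forall l k i j, cmeasurable (fun w => A w l k i j)) ->
  measurable_fun [set: T] (fun w => moment (A w)).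
Proof.
move=> mA; suff [] : cmeasurable (fun w => N%:R^-1 *
    \tr (net_eval (A w) (net_moment ell Q p))) by [].
apply: cmeasurableM; first exact: cmeasurable_cst.
exact: cmeasurable_trace_net.
Qed.

Section FixedSize.
Variables (N : nat).
Context d (T : measurableType d) (P : probability T R).
Variable A : 'I_L -> K -> T -> 'M[R[i]]_N.
Hypothesis Ameas : forall l k, random_matrix (A l k).
Hypothesis Aind : independent_families P A.
Hypothesis Ainv : exists l0, forall l, l != l0 -> permutation_invariant P (A l).
Local Notation Aw w := (fun l k => A l k w).

Lemma cmeasurable_permuted (sigma : {ffun 'I_L -> 'S_N}) l k i j :
  cmeasurable (fun w => permuted sigma (Aw w) l k i j).
Proof. by under eq_fun do rewrite mxE; exact: Ameas. Qed.

(** Conjugating all families by the inverse of the permutation of the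
    exceptional family l0 makes that permutation trivial and does not change the
    trace. *)
Lemma expectation_moment_permuted (sigma : {ffun 'I_L -> 'S_N}) :
  (\int[P]_w (moment (Aw w))%:E =
   \int[P]_w (moment (permuted sigma (Aw w)))%:E)%E.
Proof.
have [l0 inv] := Ainv.
pose rho := [ffun l => ((sigma l0)^-1 * sigma l)%g].
have -> : (fun w => (moment (permuted sigma (Aw w)))%:E) =
    (fun w => (moment (permuted rho (Aw w)))%:E).
  by apply/funext => w; rewrite /moment trace_net_permuted_mul.
pose f (a : families_space R L K N) := (moment a)%:E.
have mf : measurable_fun [set: families_space R L K N] f.
  apply/measurable_EFinP; apply: cmeasurable_moment => l k i j.
  by split=> _ U mU; rewrite classical_sets.setTI; have [] := cmeasurable_entry l k i j mU.
have mX := measurable_families Ameas.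
have mY : measurable_fun [set: T]
    (fun w => permuted rho (Aw w) : families_space R L K N).
  by apply: (@measurable_families R L K N d T (fun l k w => permuted rho (Aw w) l k))
    => l k i j; exact: cmeasurable_permuted.
apply: (ge0_integral_equal_law mX mY _ (@rectangles_setI R L K N)
  (@rectangles_setT R L K N) _ mf) => //.
  move=> B rB; apply: rectangle_permuted rB => // l.
  have [->|ll0] := eqVneq l l0; [left|right; exact: inv].
  by rewrite ffunE mulVg.
by move=> a; rewrite lee_fin moment_ge0.
Qed.

(** All the permuted moments have the same expectation, so a bound on their
    average bounds it. *)
Lemma expectation_moment_le (M : R) :
  {ae P, forall w, \sum_(sigma : {ffun 'I_L -> 'S_N}) moment (permuted sigma (Aw w))
     <= #|{ffun 'I_L -> 'S_N}|%:R * M} -> 0 <= M ->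
  (\int[P]_w (moment (Aw w))%:E <= M%:E)%E.
Proof.
move=> bnd M0; set e := (\int[P]_w _)%E; pose c := #|{ffun 'I_L -> 'S_N}|.
have c0 : (0 < c)%N by apply/card_gt0P; exists [ffun=> 1%g].
have e0 : (0 <= e)%E by apply: integral_ge0 => w _; rewrite lee_fin moment_ge0.
have mm sigma : measurable_fun [set: T] (fun w => (moment (permuted sigma (Aw w)))%:E).
  by apply/measurable_EFinP; apply: cmeasurable_moment; exact: cmeasurable_permuted.
have sumE : (\int[P]_w (\sum_(sigma : {ffun 'I_L -> 'S_N})
      (moment (permuted sigma (Aw w)))%:E) = \sum_(sigma : {ffun 'I_L -> 'S_N}) e)%E.
  rewrite ge0_integral_sum //; last by move=> sigma w _; rewrite lee_fin moment_ge0.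
  by apply: eq_bigr => sigma _; rewrite -expectation_moment_permuted.
have le1 : (\sum_(sigma : {ffun 'I_L -> 'S_N}) e <= (c%:R * M)%:E)%E.
  rewrite -sumE.
  apply: (@le_trans _ _ (\int[P]_w (cst (c%:R * M)%:E w))%E).
    apply: ae_ge0_le_integral => //.
    - by move=> w _; apply: sume_ge0 => sigma _; rewrite lee_fin moment_ge0.
    - exact: emeasurable_sum.
    - by move=> w _; rewrite lee_fin mulr_ge0.
    - apply: filterS bnd => w h _; rewrite sumEFin lee_fin; exact: h.
  rewrite integral_cst // -[leRHS]mule1; apply: lee_wpmul2l; last exact: probability_le1.
  by rewrite lee_fin mulr_ge0.
move: le1 e0; case: e {sumE} => [r| |//].
  rewrite sumEFin sumr_const -/c !lee_fin => h _.
  by rewrite -(@ler_pM2l _ c%:R) ?ltr0n // mulr_natl.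
rewrite (bigD1 ([ffun=> 1%g] : {ffun 'I_L -> 'S_N})) //= addye ?leye_eq //.
by rewrite gt_eqF // (@lt_le_trans _ _ 0%E) // sume_ge0.
Qed.

End FixedSize.
End MomentBound.

(* The trace of a power of eps eps^* is a nonnegative real number, so that
   taking its real part loses nothing. *)
Theorem theorem2p2 (R : realType) (L : nat) (K : Type)
    (disp : nat -> measure_display)
    (T : forall N : nat, measurableType (disp N))
    (P : forall N : nat, probability (T N) R)
    (A : forall N : nat, 'I_L -> K -> T N -> 'M[R[i]]_N)
    (C : R)
    (hL : (1 <= L)%N)
    (hmeas : forall N l k, random_matrix (A N l k))
    (hindep : forall N, independent_families (P N) (A N))
    (hbound : forall N,
      {ae P N, forall w : T N, forall l k, opnorm (A N l k w) <= C})
    (hperm : forall N, exists l0 : 'I_L, forall l : 'I_L, l != l0 ->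
      permutation_invariant (P N) (A N l))
    (n : nat) (hn : (2 <= n)%N)
    (ell : 'I_n -> 'I_L)
    (hell : forall i j : 'I_n, j = i.+1 :> nat -> ell i != ell j)
    (Q : 'I_n -> bmonomial (graph_monomial L K) K)
    (hQ : forall (i : 'I_n) (j : 'I_(bm_degree (Q i)).+1),
      cactus_type (bm_coef (Q i) j))
    (p : nat) (hp : (1 <= p)%N) :
  'E_(P N)[fun w =>
      let eps := epsilon (fun l k => A N l k w) ell Q in
      complex.Re (N%:R^-1 * \tr ((eps *m adjoint eps) ^+ p))%R]%E
    @[N --> \oo] --> 0%E.
Proof.
(* The bound C may be negative when no matrix is present. *)
pose c := Num.max C 0.
have c0 : 0 <= (real_complex R c) by rewrite ler0c le_max lexx orbT.
have [M M0 MP] := norm_average_trace c0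
  (@net_connected_moment L K n ell Q p)
  (@net_even_moment L K n ell Q hQ p)
  (@splittable_moment L K n ell Q hQ p hn hp hell).
pose r := complex.Re M.
have r0 : 0 <= r by move: M0; rewrite lecE => /andP[].
have Mr : M = real_complex R r by rewrite RRe_real // ger0_real.
pose V := net_vertex (net_moment ell Q p).
have bnd N : (2 * #|V| <= N)%N -> (0 < N)%N ->
    (\int[P N]_w (moment ell Q p (fun l k => A N l k w))%:E <= (N%:R^-1 * r)%:E)%E.
  move=> NV N0; apply: expectation_moment_le => //; last first.
    by rewrite mulr_ge0 ?invr_ge0.
  apply: filterS (hbound N) => w hw.
  have Ac l k : op_bounded (A N l k w) (real_complex R c).
    by apply: opnorm_op_bounded; apply: le_trans (hw l k) _; rewrite le_max lexx.
  have := MP N (fun l k => A N l k w) NV Ac.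
  set S := \sum_sigma _ => hS.
  have -> : \sum_(sigma : {ffun 'I_L -> 'S_N})
      moment ell Q p (permuted sigma (fun l k => A N l k w)) =
      complex.Re (N%:R^-1 * S).
    rewrite mulr_sumr; apply/esym.
    by apply: (big_morph (@complex.Re R)) => // -[a b] [a' b'].
  rewrite -lecR; apply: (@le_trans _ _ `|N%:R^-1 * S|).
    apply: le_trans (normc_ge_Re _); rewrite lecR; exact: ler_norm.
  rewrite normrM normfV normr_nat.
  have -> : real_complex R (#|{ffun 'I_L -> 'S_N}|%:R * (N%:R^-1 * r)) =
      N%:R^-1 * (#|{ffun 'I_L -> 'S_N}|%:R * M).
    rewrite Mr mulrCA (rmorphM (real_complex R)) (rmorphM (real_complex R)).
    by rewrite (fmorphV (real_complex R)) !(rmorph_nat (real_complex R)).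
  by rewrite ler_wpM2l // invr_ge0 ler0n.
have lim0 : (harmonic N * (2 * r))%:E @[N --> \oo] --> 0%E.
  apply: cvg_EFin; first exact: nearW.
  rewrite -(mul0r (2 * r)); apply: cvgM; first exact: cvg_harmonic.
  exact: cvg_cst.
apply: (squeeze_cvge _ (cvg_cst 0%E) lim0).
near=> N.
have N0 : (0 < N)%N by near: N; exact: nbhs_infty_gt.
have NV : (2 * #|V| <= N)%N by near: N; exact: nbhs_infty_ge.
have momentE : (fun w => (complex.Re (N%:R^-1 *
    \tr ((epsilon (fun l k => A N l k w) ell Q *m
      adjoint (epsilon (fun l k => A N l k w) ell Q)) ^+ p)))%:E) =
    (fun w => (moment ell Q p (fun l k => A N l k w))%:E).
  by apply/funext => w; rewrite /moment net_eval_moment.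
rewrite unlock /= momentE; apply/andP; split.
  by apply: integral_ge0 => w _; rewrite lee_fin moment_ge0.
apply: le_trans (bnd N NV N0) _; rewrite lee_fin /harmonic /= mulrA ler_wpM2r //.
rewrite mulrC -ler_pdivrMl // -invfM lef_pV2 ?posrE ?ltr0n ?mulr_gt0 ?ltr0n //.
by rewrite -natrM ler_nat mul2n -addnn -addn1 leq_add2l.
Unshelve. all: by end_near.
Qed.
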